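(* Let $\mathcal{K}$ be a field of characteristic zero equipped with a non-trivial absolute value that makes $\mathcal{K}$ a complete field. Then the family $(\mathcal{K}\{x_1,\ldots,x_n\})_{n}$ of rings of convergent power series is a Weierstrass family over $\mathcal{K}$. Moreover, if $\mathcal{K}$ is algebraically closed, then $(\mathcal{K}\{x_1,\ldots,x_n\})_n$ is a W-temperate family over $\mathcal{K}$.
   Context: A power series $f=\sum_{\alpha\in\mathbb{N}^n}f_\alpha\mathbf{x}^\alpha\in\mathcal{K}[[\mathbf{x}]]$ is convergent if there are real numbers $A,B>0$ with $|f_\alpha|A^{|\alpha|}\le B$ for all $\alpha$; $\mathcal{K}\{x_1,\ldots,x_n\}$ is the ring of convergent power series. Notation: $\mathbf{x}=(x_1,\ldots,x_n)$, $\mathbf{x}'=(x_1,\ldots,x_{n-1})$. Rings in other variable names are the same rings with variables renamed. Weierstrass family. Let $\mathcal{K}$ be a field of characteristic zero. A Weierstrass family over $\mathcal{K}$ is a family $(\mathcal{K}\{\!\{x_1,\ldots,x_n\}\!\})_{n\in\mathbb{N}}$ of $\mathcal{K}$-algebras such that: (i) for every $n$, $\mathcal{K}[\mathbf{x}]\subset\mathcal{K}\{\!\{\mathbf{x}\}\!\}\subset\mathcal{K}[[\mathbf{x}]]$; (ii) for all $n,m$, with $\mathbf{y}=(y_1,\ldots,y_m)$, $\mathcal{K}\{\!\{\mathbf{x},\mathbf{y}\}\!\}\cap\mathcal{K}[[\mathbf{x}]]=\mathcal{K}\{\!\{\mathbf{x}\}\!\}$; (iii) for any permutation $\sigma$ of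 $\{1,\ldots,n\}$ and $f\in\mathcal{K}\{\!\{\mathbf{x}\}\!\}$, $f(x_{\sigma(1)},\ldots,x_{\sigma(n)})\in\mathcal{K}\{\!\{\mathbf{x}\}\!\}$; (iv) if $f\in\mathcal{K}\{\!\{\mathbf{x}\}\!\}$ and $f(0)\neq0$, then $f$ is a unit in $\mathcal{K}\{\!\{\mathbf{x}\}\!\}$; (v) (Weierstrass division) if $F\in\mathcal{K}\{\!\{\mathbf{x}\}\!\}$ satisfies $F(0,x_n)=x_n^d u(x_n)$ with $u(0)\neq0$, then for every $G\in\mathcal{K}\{\!\{\mathbf{x}\}\!\}$ there are unique $Q\in\mathcal{K}\{\!\{\mathbf{x}\}\!\}$ and $R\in\mathcal{K}\{\!\{\mathbf{x}'\}\!\}[x_n]$ with $\deg_{x_n}(R)<d$ and $G=FQ+R$. W-temperate family. Let $\mathcal{K}$ be an uncountable algebraically closed field of characteristic zero. A W-temperate family over $\mathcal{K}$ is a Weierstrass family over $\mathcal{K}$ such that moreover: (a) for every $n>1$ and $f\in\mathcal{K}[[\mathbf{x}]]$, $f(\mathbf{x}',x_1x_n)\in\mathcal{K}\{\!\{\mathbf{x}\}\!\}\Rightarrow f(\mathbf{x})\in\mathcal{K}\{\!\{\mathbf{x}\}\!\}$; (b) for every $F\in\mathcal{K}[[\mathbf{x}]]\setminus\mathcal{K}\{\!\{\mathbf{x}\}\!\}$, setting $W=\{\lambda\in\mathcal{K}: F(\mathbf{x}',\lambda x_1)\in\mathcal{K}\{\!\{\mathbf{x}'\}\!\}\}$, the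 set $\mathcal{K}\setminus W$ is uncountable; (c) let $\mathbf{x}=(x_1,x_2)$, $\alpha\in\mathbb{N}^*$, and let $\Gamma(t,z)\in\mathcal{K}[t,z]$ be irreducible, monic in $z$, and split in $\mathcal{K}\{\!\{t\}\!\}[z]$; let $\gamma(t),\gamma'(t)\in\mathcal{K}\{\!\{t\}\!\}$ be two roots of $\Gamma$; let $P(\mathbf{x},z)=\sum_{k\in\mathbb{N}}x_1^kp_k(x_2,z)\in\mathcal{K}[[\mathbf{x}]][z]$ with $p_k\in\mathcal{K}[x_2,z]$ and $\deg_{x_2}(p_k)\le\alpha k$ for all $k$. Then $P(\mathbf{x},\gamma(x_2))\in\mathcal{K}\{\!\{\mathbf{x}\}\!\}\Rightarrow P(\mathbf{x},\gamma'(x_2))\in\mathcal{K}\{\!\{\mathbf{x}\}\!\}$. *)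

(* Defs.v *)
From HB Require Import structures.
From mathcomp Require Import all_boot all_order all_algebra all_fingroup.
From mathcomp Require Import boolp classical_sets cardinality reals.
From mathcomp Require Import mpoly.

Set Implicit Arguments.
Unset Strict Implicit.
Unset Printing Implicit Defensive.

Import Order.TTheory GRing.Theory Num.Theory.

Local Open Scope ring_scope.

(* [mfps n K] is K[[x_1, ..., x_n]]: a series is its family of coefficients,
   indexed by the exponents 'X_{1..n} of multinomials.  It is wrapped in a
   record so that it does not inherit the pointwise product of functions. *)
Record mfps (n : nat) (K : Type) := MFPS { mfps_coeff :> 'X_{1..n} -> K }.

HB.instance Definition _ (n : nat) (K : Type) := gen_eqMixin (mfps n K).
HB.instance Definition _ (n : nat) (K : Type) := gen_choiceMixin (mfps n K).

Lemma mfpsP (n : nat) (K : Type) (f g : mfps n K) :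
  (forall m, f m = g m) -> f = g.
Proof. by case: f g => f [g] /= fg; congr MFPS; apply/funext. Qed.

Section MfpsRing.
Variables (n : nat) (K : comNzRingType).
Implicit Types (f g h : mfps n K) (m : 'X_{1..n}).

Definition mfps0 : mfps n K := MFPS (fun=> 0).
Definition mfps_add f g : mfps n K := MFPS (fun m => f m + g m).
Definition mfps_opp f : mfps n K := MFPS (fun m => - f m).
Definition mfps_scale (a : K) f : mfps n K := MFPS (fun m => a * f m).
Definition mfps_of_mpoly (p : {mpoly K[n]}) : mfps n K := MFPS (fun m => p@_m).
Definition mfps1 : mfps n K := mfps_of_mpoly 1.
(* Cauchy product; the degree bounds on k only make the index type finite. *)
Definition mfps_mul f g : mfps n K := MFPS (fun m =>
  \sum_(k : 'X_{1..n < (mdeg m).+1, (mdeg m).+1} | m == (k.1 + k.2)%MM)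
     f k.1 * g k.2).

Let mfps_addA : associative mfps_add.
Proof. by move=> f g h; apply: mfpsP => m /=; rewrite addrA. Qed.
Let mfps_addC : commutative mfps_add.
Proof. by move=> f g; apply: mfpsP => m /=; rewrite addrC. Qed.
Let mfps_add0 : left_id mfps0 mfps_add.
Proof. by move=> f; apply: mfpsP => m /=; rewrite add0r. Qed.
Let mfps_addN : left_inverse mfps0 mfps_opp mfps_add.
Proof. by move=> f; apply: mfpsP => m /=; rewrite addNr. Qed.

HB.instance Definition _ :=
  GRing.isZmodule.Build (mfps n K) mfps_addA mfps_addC mfps_add0 mfps_addN.

(* The ring axioms are transported from {mpoly K[n]} by truncation. *)
Definition mfps_trunc (d : nat) f : {mpoly K[n]} :=
  \sum_(k : 'X_{1..n < d}) f k *: 'X_[k].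

Lemma mfps_truncE d f m : (mdeg m < d)%N -> (mfps_trunc d f)@_m = f m.
Proof.
move=> md; rewrite raddf_sum (bigD1 (BMultinom md)) //= mcoeffZ mcoeffX eqxx.
rewrite mulr1 big1 ?addr0 // => k kNm; rewrite mcoeffZ mcoeffX.
case: eqP => [km|]; last by rewrite mulr0.
by case/eqP: kNm; apply: val_inj.
Qed.

Let mul_agree d f g (p q : {mpoly K[n]}) :
  (forall m, (mdeg m < d)%N -> f m = p@_m) ->
  (forall m, (mdeg m < d)%N -> g m = q@_m) ->
  forall m, (mdeg m < d)%N -> mfps_mul f g m = (p * q)@_m.
Proof.
move=> fp gq m md; rewrite mcoeffM /=; apply: eq_bigr => k _.
by rewrite fp ?gq // (leq_trans (bmdeg _)).
Qed.

Let trunc_agree d f m : (mdeg m < d)%N -> f m = (mfps_trunc d f)@_m.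
Proof. by move=> md; rewrite mfps_truncE. Qed.

Let mfps_mulA : associative mfps_mul.
Proof.
move=> f g h; apply: mfpsP => m; pose d := (mdeg m).+1.
have A := @trunc_agree d.
rewrite (mul_agree (A f) (mul_agree (A g) (A h))) //.
by rewrite (mul_agree (mul_agree (A f) (A g)) (A h)) // mulrA.
Qed.

Let mfps_mulC : commutative mfps_mul.
Proof.
move=> f g; apply: mfpsP => m; have A := @trunc_agree (mdeg m).+1.
by rewrite (mul_agree (A f) (A g)) // (mul_agree (A g) (A f)) // mulrC.
Qed.

Let mfps_mul1 : left_id mfps1 mfps_mul.
Proof.
move=> f; apply: mfpsP => m; have A := @trunc_agree (mdeg m).+1.
have A1 k : (mdeg k < (mdeg m).+1)%N -> mfps1 k = (1 : {mpoly K[n]})@_k by [].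
by rewrite (mul_agree A1 (A f)) // mul1r -A.
Qed.

Let mfps_mulDl : left_distributive mfps_mul +%R.
Proof.
move=> f g h; apply: mfpsP => m /=; rewrite -big_split /=.
by apply: eq_bigr => k _; rewrite mulrDl.
Qed.

Let mfps_oner_neq0 : mfps1 != 0.
Proof.
apply/eqP => /(congr1 (fun f : mfps n K => f 0%MM)) /= /eqP.
by rewrite mcoeff1 eqxx oner_eq0.
Qed.

HB.instance Definition _ := GRing.Zmodule_isComNzRing.Build (mfps n K)
  mfps_mulA mfps_mulC mfps_mul1 mfps_mulDl mfps_oner_neq0.

Let mfps_scaleA a b f : mfps_scale a (mfps_scale b f) = mfps_scale (a * b) f.
Proof. by apply: mfpsP => m /=; rewrite mulrA. Qed.
Let mfps_scale1 : left_id 1 mfps_scale.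
Proof. by move=> f; apply: mfpsP => m /=; rewrite mul1r. Qed.
Let mfps_scaleDr : right_distributive mfps_scale +%R.
Proof. by move=> a f g; apply: mfpsP => m /=; rewrite mulrDr. Qed.
Let mfps_scaleDl f : {morph mfps_scale^~ f : a b / a + b}.
Proof. by move=> a b; apply: mfpsP => m /=; rewrite mulrDl. Qed.

HB.instance Definition _ := GRing.Zmodule_isLmodule.Build K (mfps n K)
  mfps_scaleA mfps_scale1 mfps_scaleDr mfps_scaleDl.

Let mfps_scaleAl (a : K) f g : a *: (f * g) = (a *: f) * g.
Proof.
by apply: mfpsP => m /=; rewrite mulr_sumr; apply: eq_bigr => k _; rewrite mulrA.
Qed.

HB.instance Definition _ :=
  GRing.Lmodule_isLalgebra.Build K (mfps n K) mfps_scaleAl.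
HB.instance Definition _ := GRing.Lalgebra_isComAlgebra.Build K (mfps n K).

Definition mfpsX (i : 'I_n) : mfps n K := mfps_of_mpoly 'X_i.

End MfpsRing.

Arguments mfps_of_mpoly {n K} p.
Arguments mfpsX {n K} i.

(* f(g_1, ..., g_n), for g_i without constant term: then \prod_i g_i ^+ k_i has
   order at least |k|, so only the exponents k with |k| <= |m| contribute to
   the coefficient of degree m.  The value is meaningless for other g. *)
Definition mfps_subst (n p : nat) (K : comNzRingType)
    (g : 'I_n -> mfps p K) (f : mfps n K) : mfps p K :=
  MFPS (fun m => \sum_(k : 'X_{1..n < (mdeg m).+1})
    f k * (\prod_(i < n) g i ^+ (k : 'X_{1..n}) i : mfps p K) m).

(* f(x_{s(1)}, ..., x_{s(n)}); for injective s, the inclusion of the series in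
   n variables into the series in p variables. *)
Definition mfps_rename (n p : nat) (K : comNzRingType) (s : 'I_n -> 'I_p)
    (f : mfps n K) : mfps p K :=
  mfps_subst (fun i => mfpsX (s i)) f.

(* K[[x']] is included in K[[x]], with x' = (x_1, ..., x_n) and
   x = (x_1, ..., x_{n+1}). *)
Definition mfps_incl (n : nat) (K : comNzRingType) (f : mfps n K) :
  mfps n.+1 K := mfps_rename (widen_ord (leqnSn n)) f.

(* Irreducibility in a domain; irreducible_poly of polydiv.v is not suited to
   coefficients in a ring such as K[t]. *)
Definition ring_irreducible (A : idomainType) (a : A) : Prop :=
  [/\ a != 0, a \isn't a GRing.unit &
      forall b c : A, a = b * c -> b \is a GRing.unit \/ c \is a GRing.unit].

Section Families.
Variable K : fieldType.
Variable S : forall n : nat, {pred mfps n K}.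
Arguments S n : clear implicits.

(* Weierstrass division with respect to the last variable of F, among n + 1.
   The remainder is a polynomial r over the series in x', seen in K[[x]] by
   evaluation at x_{n+1}; size r <= d means that the degree of r is < d. *)
Definition weierstrass_division : Prop :=
  forall (n d : nat) (F G : mfps n.+1 K) (u : mfps 1 K),
    F \in S n.+1 -> G \in S n.+1 ->
    mfps_subst (fun i => if i == ord_max then mfpsX ord0 else 0) F
      = mfpsX ord0 ^+ d * u ->
    u 0%MM != 0 ->
    exists! qr : mfps n.+1 K * {poly mfps n K},
      [/\ qr.1 \in S n.+1, qr.2 \is a polyOver (S n), (size qr.2 <= d)%N &
          G = F * qr.1 + (map_poly (@mfps_incl n K) qr.2).[mfpsX ord_max]].

Record Weierstrass_family : Prop := {
  wf_char0 : [pchar K] =i pred0;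
  wf_subalg : forall n, GRing.subalg_closed (S n);
  wf_mpoly : forall n (p : {mpoly K[n]}), mfps_of_mpoly p \in S n;
  wf_inter : forall n m (f : mfps n K),
    (mfps_rename (@lshift n m) f \in S (n + m)) = (f \in S n);
  wf_perm : forall n (s : {perm 'I_n}) (f : mfps n K),
    f \in S n -> mfps_rename s f \in S n;
  wf_unit : forall n (f : mfps n K), f \in S n -> f 0%MM != 0 ->
    exists2 g, g \in S n & f * g = 1;
  wf_division : weierstrass_division }.

(* With n + 2 variables: x_1 is ord0 and the last variable is ord_max. *)
Definition temperate_blowup : Prop :=
  forall (n : nat) (f : mfps n.+2 K),
    mfps_subst (fun i => if i == ord_max then mfpsX ord0 * mfpsX ord_max
                         else mfpsX i) f \in S n.+2 ->
    f \in S n.+2.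

(* F(x', lambda x_1) is computed in K[[x]] and required to come from an element
   of the family in the variables x'. *)
Definition temperate_slices : Prop :=
  forall (n : nat) (F : mfps n.+1 K), F \notin S n.+1 ->
    let W := [set lam : K | exists2 h, h \in S n &
      mfps_incl h = mfps_subst (fun i => if i == ord_max then lam *: mfpsX ord0
                                         else mfpsX i) F]%classic in
    ~ countable (~` W)%classic.

(* K[t, z] is {poly {poly K}}, with z the outer variable; it is sent to
   K[[t]][z] by mapping horner_alg on the coefficients. *)
Definition splits_in (Gam : {poly {poly K}}) : Prop :=
  exists2 rs : seq (mfps 1 K), {subset rs <= S 1} &
    map_poly (horner_alg (mfpsX ord0 : mfps 1 K)) Gam
      = \prod_(a <- rs) ('X - a%:P).

(* p_k(x_2, z) is in {poly {poly K}} with z the outer variable, and P is the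
   series \sum_k x_1^k p_k(x_2, z), coefficient by coefficient. *)
Definition is_graded_sum (p : nat -> {poly {poly K}}) (P : {poly mfps 2 K}) :
    Prop :=
  forall (i : nat) (m : 'X_{1..2}), P`_i m = ((p (m ord0))`_i)`_(m ord_max).

(* P(x, g(x_2)) *)
Definition eval_at_series (P : {poly mfps 2 K}) (g : mfps 1 K) : mfps 2 K :=
  P.[mfps_rename (fun=> ord_max) g].

Definition temperate_conjugate : Prop :=
  forall (al : nat) (Gam : {poly {poly K}}) (g g' : mfps 1 K)
    (p : nat -> {poly {poly K}}) (P : {poly mfps 2 K}),
    (0 < al)%N ->
    ring_irreducible Gam -> Gam \is monic -> splits_in Gam ->
    g \in S 1 -> g' \in S 1 ->
    root (map_poly (horner_alg (mfpsX ord0 : mfps 1 K)) Gam) g ->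
    root (map_poly (horner_alg (mfpsX ord0 : mfps 1 K)) Gam) g' ->
    (forall k i, (size ((p k)`_i)%R <= (al * k).+1)%N) ->
    is_graded_sum p P ->
    eval_at_series P g \in S 2 -> eval_at_series P g' \in S 2.

Record W_temperate_family : Prop := {
  wt_uncountable : ~ countable [set: K]%classic;
  wt_closed : GRing.closed_field_axiom K;
  wt_weierstrass : Weierstrass_family;
  wt_blowup : temperate_blowup;
  wt_slices : temperate_slices;
  wt_conjugate : temperate_conjugate }.

End Families.

Section Convergent.
Variables (R : realType) (K : fieldType) (v : K -> R).

Record absolute_value : Prop := {
  av_ge0 : forall x, 0 <= v x;
  av_eq0 : forall x, v x = 0 <-> x = 0;
  av_mul : forall x y, v (x * y) = v x * v y;
  av_add : forall x y, v (x + y) <= v x + v y }.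

Definition nontrivial_absolute_value : Prop :=
  exists2 x, x != 0 & v x != 1.

Definition complete_absolute_value : Prop :=
  forall u : nat -> K,
    (forall e, 0 < e -> exists N, forall i j, (N <= i)%N -> (N <= j)%N ->
       v (u i - u j) < e) ->
    exists l, forall e, 0 < e -> exists N, forall i, (N <= i)%N ->
       v (u i - l) < e.

Definition convergent (n : nat) : {pred mfps n K} :=
  [pred f : mfps n K | `[< exists A B : R,
     [/\ 0 < A, 0 < B & forall m, v (f m) * A ^+ mdeg m <= B] >]].

End Convergent.

Arguments convergent {R K} v n.

(* Main.v *)
Require Import Defs.
From mathcomp Require Import all_boot all_order all_algebra all_fingroup.
From mathcomp Require Import boolp classical_sets cardinality reals.
From mathcomp Require Import mpoly.
From mathcomp Require Import zify ring lra.

(** The norm of a power series is its l1-norm on a polydisc of given radii; it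
    is submultiplicative, and a series converges iff this norm is finite for
    some positive radii.

    Units and Weierstrass division are both Neumann series \sum_j T^j: T raises
    a degree, so each coefficient is a finite sum, and T is a contraction on a
    suitable small polydisc.

    (b) The coefficients of F(x', lambda x_1) are polynomials in lambda, and the
    convergence of F(x', lambda x_1) bounds them geometrically in their degree.
    If this happens for all lambda outside a countable set, then by Baire's
    theorem the bounds hold uniformly on a ball, and a Cauchy estimate for
    polynomials over an algebraically closed field bounds the coefficients of
    these polynomials, which are those of F.

    (c) Let g and g' be roots of Gam.  By counting dimensions there is a in
    K[t, z], not divisible by Gam, of weighted degree < M, with a(b) divisible
    by t^M at every root b <> g.  For f in K[t, z] of degree < N, up to a
    constant, the remainder of f a^N Gam' modulo Gam has degree < M N in t, and
    modulo t^(M N) Lagrange interpolation expresses it by f(g) alone.  So its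
    size, hence that of f(g') a(g')^N Gam'(g'), is controlled by that of f(g),
    with a loss that is only exponential in N. *)

Set Implicit Arguments.
Unset Strict Implicit.
Unset Printing Implicit Defensive.

Import Order.TTheory GRing.Theory Num.Theory.

Local Open Scope ring_scope.

(** * Formal power series *)

Lemma leq_mdeg n (m : 'X_{1..n}) i : (m i <= mdeg m)%N.
Proof. by rewrite mdegE (bigD1 i) //= leq_addr. Qed.

Section FormalSeries.
Variables (n : nat) (K : comNzRingType).
Implicit Types (f g h : mfps n K) (m k : 'X_{1..n}).

Lemma mfpsDE f g m : (f + g) m = f m + g m. Proof. by []. Qed.
Lemma mfpsNE f m : (- f) m = - f m. Proof. by []. Qed.
Lemma mfpsZE a f m : (a *: f) m = a * f m. Proof. by []. Qed.
Lemma mfps0E m : (0 : mfps n K) m = 0. Proof. by []. Qed.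
Lemma mfps1E m : (1 : mfps n K) m = (m == 0%MM)%:R.
Proof. by rewrite -[LHS]/((1 : {mpoly K[n]})@_m) mcoeff1. Qed.
Lemma mfps_sumE (I : Type) (r : seq I) (P : pred I) (F : I -> mfps n K) m :
  (\sum_(i <- r | P i) F i) m = \sum_(i <- r | P i) F i m.
Proof. exact: (big_morph (fun f : mfps n K => f m)). Qed.

(** The index set depends on [d] only, so that one set serves a whole finite family of exponents
    [m]. *)
Lemma mfpsM_wide d f g m : (mdeg m < d)%N ->
  (f * g) m = \sum_(k : 'X_{1..n < d, d} | m == (k.1 + k.2)%MM) f k.1 * g k.2.
Proof.
move=> md; transitivity ((mfps_trunc d f * mfps_trunc d g)@_m).
  rewrite mcoeffM /=; apply: eq_bigr => k _.
  by rewrite !mfps_truncE // (leq_trans (bmdeg _)).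
rewrite (@mcoeff_poly_mul _ _ _ _ _ _ md); apply: eq_bigr => k _.
by rewrite !mfps_truncE // bmdeg.
Qed.

(** Only the support of [g] below [m] matters: [s] can be a single exponent when [g] is a monomial,
    or a line of exponents when [g] involves one variable. *)
Lemma mfpsM_seq f g m (s : seq 'X_{1..n}) : uniq s ->
  (forall k, k \in s -> (k <= m)%MM) ->
  (forall k, (k <= m)%MM -> g k != 0 -> k \in s) ->
  (f * g) m = \sum_(k <- s) f (m - k)%MM * g k.
Proof.
move=> us sm gs; have md : (mdeg m < (mdeg m).+1)%N by [].
transitivity ((mfps_trunc (mdeg m).+1 g * mfps_trunc (mdeg m).+1 f)@_m).
  rewrite mulrC mcoeffM /=; apply: eq_bigr => k _.
  by rewrite !mfps_truncE ?bmdeg.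
rewrite (@mcoeff_poly_mul_lin _ _ _ _ _ _ md).
have dk k : (k <= m)%MM -> (mdeg k < (mdeg m).+1)%N.
  by move=> km; rewrite -(submK km) mdegD ltnS leq_addl.
pose t := [seq k : 'X_{1..n} | k : 'X_{1..n < (mdeg m).+1} <-
  enum [pred k : 'X_{1..n < (mdeg m).+1} | (k <= m)%MM & g k != 0]].
transitivity (\sum_(k <- t) f (m - k)%MM * g k).
  rewrite big_map big_enum /= [LHS](bigID [pred k : 'X_{1..n < (mdeg m).+1} | g k != 0]) /=.
  rewrite [X in _ + X]big1 ?addr0; last first.
    by move=> k /andP[km]; rewrite negbK mfps_truncE ?bmdeg // => /eqP ->; rewrite mul0r.
  apply: eq_bigr => k /andP[km _]; rewrite mulrC !mfps_truncE ?bmdeg //.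
  by rewrite ltnS mdegB.
rewrite [RHS](bigID [pred k | g k != 0]) /= [X in _ = _ + X]big1 ?addr0; last first.
  by move=> k; rewrite negbK => /eqP ->; rewrite mulr0.
rewrite -[RHS]big_filter; apply: perm_big; apply: uniq_perm.
- by rewrite map_inj_uniq ?enum_uniq //; apply: val_inj.
- by rewrite filter_uniq.
move=> k; rewrite mem_filter /=; apply/mapP/andP => [[k']|[gk ks]].
  by rewrite mem_enum inE => /andP[km gk] ->; split=> //; apply: gs.
exists (BMultinom (dk k (sm k ks))) => //; rewrite mem_enum inE /= gk andbT.
exact: sm.
Qed.

Lemma mfpsM_eq0 f g m :
  (forall k l, (k + l)%MM = m -> f k * g l = 0) -> (f * g) m = 0.
Proof.
by move=> fg0; apply: big1 => k /eqP mE; apply: fg0.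
Qed.

Lemma mfps_of_mpolyM : {morph (@mfps_of_mpoly n K) : p q / p * q}.
Proof. by move=> p q; apply: mfpsP => m /=; rewrite mcoeffM. Qed.

Definition mfpsXm k : mfps n K := mfps_of_mpoly 'X_[k].

Lemma mfpsXmE k m : mfpsXm k m = (k == m)%:R.
Proof. by rewrite -mcoeffX. Qed.

Lemma mfpsXmD k l : mfpsXm (k + l) = mfpsXm k * mfpsXm l.
Proof. by rewrite /mfpsXm mpolyXD mfps_of_mpolyM. Qed.

Lemma mfpsXm0 : mfpsXm 0 = 1.
Proof. by rewrite /mfpsXm mpolyX0. Qed.

Lemma mfpsXm_muln k i : mfpsXm (k *+ i) = mfpsXm k ^+ i.
Proof.
elim: i => [|i IH]; first by rewrite mulm0n mfpsXm0 expr0.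
by rewrite mulmS mfpsXmD exprS IH.
Qed.

Lemma mfpsXm_sum (I : Type) (r : seq I) (P : pred I) (F : I -> 'X_{1..n}) :
  mfpsXm (\sum_(i <- r | P i) F i) = \prod_(i <- r | P i) mfpsXm (F i).
Proof. exact: (big_morph _ mfpsXmD mfpsXm0). Qed.

Lemma mfpsX_Xm i : mfpsX i = mfpsXm U_(i) :> mfps n K.
Proof. by []. Qed.

Lemma mfpsMXm f k m :
  (f * mfpsXm k) m = if (k <= m)%MM then f (m - k)%MM else 0.
Proof.
case: ifPn => km.
  rewrite (@mfpsM_seq _ _ _ [:: k]) ?big_seq1 //.
  - by rewrite mfpsXmE eqxx mulr1.
  - by move=> l; rewrite inE => /eqP ->.
  - by move=> l _; rewrite mfpsXmE inE [l == k]eq_sym; case: (k == l); rewrite ?eqxx.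
apply: mfpsM_eq0 => l l' mE; rewrite mfpsXmE.
case: eqP => [E|]; last by rewrite mulr0.
by rewrite -mE -E lem_addl in km.
Qed.

Lemma mfpsMXm_add f k m : (f * mfpsXm k) (m + k)%MM = f m.
Proof. by rewrite mfpsMXm lem_addl addmK. Qed.

End FormalSeries.

(** * Substitution of scaled monomials for the variables *)

Section MonomialSubstitution.
Variables (n p : nat) (K : comNzRingType).
Variables (c : 'I_n -> K) (e : 'I_n -> 'X_{1..p}) (g : 'I_n -> mfps p K).
Hypothesis gE : forall i, g i = c i *: mfpsXm K (e i).
Hypothesis e_gt0 : forall i, (0 < mdeg (e i))%N.
Implicit Types (f : mfps n K).

(** The substitution sends the monomial of exponent [k] to a constant times the monomial of this
    exponent. *)
Definition mnm_push (k : 'X_{1..n}) : 'X_{1..p} := (\sum_(i < n) e i *+ k i)%MM.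

Lemma mnm_pushE k j : mnm_push k j = (\sum_(i < n) e i j * k i)%N.
Proof. by rewrite mnm_sumE; apply: eq_bigr => i _; rewrite mulmnE. Qed.

Lemma mdeg_push k : mdeg (mnm_push k) = (\sum_(i < n) mdeg (e i) * k i)%N.
Proof. by rewrite mdeg_sum; apply: eq_bigr => i _; rewrite mdegMn. Qed.

Lemma mdeg_push_ge k : (mdeg k <= mdeg (mnm_push k))%N.
Proof.
rewrite mdegE mdeg_push; apply: leq_sum => i _.
by rewrite leq_pmull.
Qed.

Lemma subst_monomE f m : mfps_subst g f m =
  \sum_(k : 'X_{1..n < (mdeg m).+1} | mnm_push k == m)
     f k * \prod_(i < n) c i ^+ (k : 'X_{1..n}) i.
Proof.
rewrite [RHS]big_mkcond /=; apply: eq_bigr => k _.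
have -> : \prod_(i < n) g i ^+ (k : 'X_{1..n}) i =
    (\prod_(i < n) c i ^+ (k : 'X_{1..n}) i) *: mfpsXm K (mnm_push k).
  rewrite mfpsXm_sum -scaler_prod; apply: eq_bigr => i _.
  by rewrite gE exprZn mfpsXm_muln.
by rewrite mfpsZE mfpsXmE; case: eqP; rewrite ?mulr1 // !mulr0.
Qed.

(** Several exponents may be pushed to [m]; the hypothesis lets the scalars [c] kill all but one of
    them, as happens when some variables are set to 0. *)
Lemma subst_monom_uniq f m (k : 'X_{1..n}) : mnm_push k = m ->
  (forall k' : 'X_{1..n}, mnm_push k' = m -> k' <> k ->
     \prod_(i < n) c i ^+ k' i = 0) ->
  mfps_subst g f m = f k * \prod_(i < n) c i ^+ k i.
Proof.
move=> km kU; rewrite subst_monomE.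
have kd : (mdeg k < (mdeg m).+1)%N by rewrite ltnS -km mdeg_push_ge.
rewrite (bigD1 (BMultinom kd)) /=; last exact/eqP.
rewrite [X in _ + X]big1 ?addr0 // => k' /andP[/eqP k'm nk]; rewrite kU ?mulr0 //.
by move=> kk; case/eqP: nk; apply: val_inj.
Qed.

Lemma subst_monom0 f m : (forall k, mnm_push k != m) -> mfps_subst g f m = 0.
Proof.
by move=> km; rewrite subst_monomE big1 // => k; rewrite (negPf (km _)).
Qed.

End MonomialSubstitution.

Section Rename.
Variables (n p : nat) (K : comNzRingType) (s : 'I_n -> 'I_p).
Hypothesis s_inj : injective s.
Implicit Types (f : mfps n K).

Definition mnm_rename := mnm_push (fun i => U_(s i))%MM.

Lemma mnm_renameE k i : mnm_rename k (s i) = k i.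
Proof.
rewrite mnm_pushE (bigD1 i) //= mnm1E eqxx mul1n big1 ?addn0 // => j ji.
by rewrite mnm1E (inj_eq s_inj) (negPf ji).
Qed.

Lemma mdeg_rename k : mdeg (mnm_rename k) = mdeg k.
Proof.
by rewrite mdeg_push mdegE; apply: eq_bigr => i _; rewrite mdeg1 mul1n.
Qed.

Lemma mnm_rename_inj : injective mnm_rename.
Proof.
by move=> k l kl; apply/mnmP => i; rewrite -!mnm_renameE kl.
Qed.

Lemma mfps_renameE f k : mfps_rename s f (mnm_rename k) = f k.
Proof.
rewrite /mfps_rename (@subst_monom_uniq _ _ _ (fun=> 1) (fun i => U_(s i))%MM _ _ _ f _ k) //.
- by rewrite big1 ?mulr1 // => i _; rewrite expr1n.
- by move=> i; rewrite scale1r mfpsX_Xm.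
- by move=> i; rewrite mdeg1.
- by move=> k' /mnm_rename_inj.
Qed.

Lemma mfps_rename0 f m : (forall k, mnm_rename k != m) -> mfps_rename s f m = 0.
Proof.
apply: (@subst_monom0 _ _ _ (fun=> 1)) => i; first by rewrite scale1r mfpsX_Xm.
Qed.

End Rename.

(** * Absolute values and the l1-norm *)

Section AbsoluteValue.
Variables (R : realType) (K : fieldType) (v : K -> R).
Hypothesis v_abs : absolute_value v.

Lemma av0 : v 0 = 0. Proof. exact/(av_eq0 v_abs). Qed.

Lemma av_gt0 x : x != 0 -> 0 < v x.
Proof.
move=> x0; rewrite lt_def (av_ge0 v_abs) andbT; apply: contra x0.
by move=> /eqP/(av_eq0 v_abs)/eqP.
Qed.

Lemma av1 : v 1 = 1.
Proof.
have v1 : v 1 != 0 by rewrite gt_eqF // av_gt0 // oner_neq0.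
by apply: (mulfI v1); rewrite -(av_mul v_abs) !mulr1.
Qed.

Lemma avX x i : v (x ^+ i) = v x ^+ i.
Proof. by elim: i => [|i IH]; rewrite ?expr0 ?av1 // !exprS (av_mul v_abs) IH. Qed.

Lemma avN x : v (- x) = v x.
Proof.
apply/eqP; rewrite -(@eqrXn2 _ 2) ?(av_ge0 v_abs) //.
by rewrite -!avX sqrrN.
Qed.

Lemma avV x : v x^-1 = (v x)^-1.
Proof.
have [->|x0] := eqVneq x 0; first by rewrite invr0 av0 invr0.
have vx := av_gt0 x0; apply: (mulfI (lt0r_neq0 vx)).
by rewrite -(av_mul v_abs) !divff ?av1 // lt0r_neq0.
Qed.

Lemma av_sum (I : Type) (r : seq I) (P : pred I) (F : I -> K) :
  v (\sum_(i <- r | P i) F i) <= \sum_(i <- r | P i) v (F i).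
Proof.
elim/big_rec2: _ => [|i x y _ xy]; first by rewrite av0.
by rewrite (le_trans (av_add v_abs _ _)) // lerD2l.
Qed.

Lemma avB x y : v (x - y) <= v x + v y.
Proof. by rewrite -(avN y) (av_add v_abs). Qed.

End AbsoluteValue.

Lemma ler_sum_subset (R : numDomainType) (I : eqType) (s t : seq I) (F : I -> R) :
  uniq s -> uniq t -> {subset s <= t} -> (forall i, 0 <= F i) ->
  \sum_(i <- s) F i <= \sum_(i <- t) F i.
Proof.
move=> us ut st F0; rewrite [leRHS](bigID (mem s)) /=.
have -> : \sum_(i <- s) F i = \sum_(i <- t | i \in s) F i.
  rewrite -[RHS]big_filter; apply/perm_big/uniq_perm; rewrite ?filter_uniq //.
  by move=> i; rewrite mem_filter; case: (boolP (i \in s)) => // /st ->.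
by rewrite lerDl sumr_ge0.
Qed.

(** * Weights of monomials and geometric sums *)

Section Weights.
Variables (R : realType) (n : nat).
Implicit Types (A : 'I_n -> R) (k m : 'X_{1..n}).

Definition wt A k : R := \prod_i A i ^+ k i.

Lemma wtD A k m : wt A (k + m)%MM = wt A k * wt A m.
Proof.
by rewrite /wt -big_split; apply: eq_bigr => i _; rewrite mnmDE exprD.
Qed.

Lemma wt0 A : wt A 0%MM = 1.
Proof. by rewrite /wt big1 // => i _; rewrite mnm0E expr0. Qed.

Lemma wt_muln A k j : wt A (k *+ j)%MM = wt A k ^+ j.
Proof.
elim: j => [|j IH]; first by rewrite mulm0n wt0 expr0.
by rewrite mulmS wtD IH exprS.
Qed.

Lemma wtU A i : wt A U_(i)%MM = A i.
Proof.
rewrite /wt (bigD1 i) //= mnm1E eqxx expr1 big1 ?mulr1 // => j ji.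
by rewrite mnm1E eq_sym (negPf ji) expr0.
Qed.

Lemma wt_const (a : R) k : wt (fun=> a) k = a ^+ mdeg k.
Proof. by rewrite mdegE /wt (big_morph (fun i => a ^+ i) (exprD a) (expr0 a)). Qed.

Lemma wt_ge0 A k : (forall i, 0 <= A i) -> 0 <= wt A k.
Proof. by move=> A0; apply: prodr_ge0 => i _; apply: exprn_ge0. Qed.

Lemma le_wt A A' k : (forall i, 0 <= A' i <= A i) -> wt A' k <= wt A k.
Proof.
move=> AA; apply: ler_prod => i _; have /andP[A0 A1] := AA i.
by rewrite exprn_ge0 // lerXn2r // nnegrE // (le_trans A0).
Qed.

Lemma sum_half_pow d : \sum_(j < d) (2^-1 : R) ^+ j <= 2.
Proof.
have -> : \sum_(j < d) (2^-1 : R) ^+ j = 2 - 2 * 2^-1 ^+ d.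
  elim: d => [|d IH]; first by rewrite big_ord0 expr0; lra.
  by rewrite big_ord_recr /= IH exprS; field.
have : 0 <= (2^-1 : R) ^+ d by rewrite exprn_ge0 // invr_ge0.
lra.
Qed.

(** The exponents of [s] lie in a cube, over which the sum factors into [n] geometric sums, each at
    most 2. *)
Lemma sum_half_mdeg (s : seq 'X_{1..n}) : uniq s ->
  \sum_(k <- s) (2^-1 : R) ^+ mdeg k <= 2 ^+ n.
Proof.
move=> us; have [d sd] : exists d, forall k, k \in s -> forall i, (k i < d)%N.
  exists (\max_(k <- s) mdeg k).+1 => k ks i; rewrite ltnS.
  exact: leq_trans (leq_mdeg _ _) (@leq_bigmax_seq _ s predT mdeg k ks isT).
pose b (k : {ffun 'I_n -> 'I_d}) : 'X_{1..n} := [multinom (k i : nat) | i < n].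
have b_inj : injective b.
  move=> k l /mnmP kl; apply/ffunP => i; apply: val_inj.
  by have := kl i; rewrite /b !mnmE.
apply: (@le_trans _ _ (\sum_(k : {ffun 'I_n -> 'I_d}) (2^-1 : R) ^+ mdeg (b k))).
  rewrite -(big_map b predT (fun k => (2^-1 : R) ^+ mdeg k)) /=.
  apply: ler_sum_subset => // [|k ks|k]; last by rewrite exprn_ge0 // invr_ge0.
    by rewrite map_inj_uniq ?index_enum_uniq.
  apply/mapP; exists [ffun i => Ordinal (sd k ks i)]; first by rewrite mem_index_enum.
  by apply/mnmP => i; rewrite mnmE ffunE.
under eq_bigr do rewrite -wt_const /wt.
have -> : \sum_(k : {ffun 'I_n -> 'I_d}) \prod_i (2^-1 : R) ^+ b k i =
    \prod_(i < n) \sum_(j < d) (2^-1 : R) ^+ j.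
  rewrite bigA_distr_bigA; apply: eq_bigr => k _; apply: eq_bigr => i _.
  by rewrite mnmE.
rewrite -[X in _ <= _ ^+ X](card_ord n) -prodr_const; apply: ler_prod => i _.
by rewrite sum_half_pow andbT sumr_ge0 // => j _; rewrite exprn_ge0 // invr_ge0.
Qed.

End Weights.

Section L1Norm.
Variables (R : realType) (K : fieldType) (v : K -> R).
Hypothesis v_abs : absolute_value v.
Variable n : nat.
Implicit Types (A : 'I_n -> R) (k m : 'X_{1..n}) (f g h : mfps n K).

(** A bound on the l1-norm, expressed by finite partial sums so that no infinite sum has to be
    formed. *)
Definition l1le A (B : R) f :=
  forall s, uniq s -> \sum_(k <- s) v (f k) * wt A k <= B.

Lemma l1le_coef A B f m : l1le A B f -> v (f m) * wt A m <= B.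
Proof. by move=> /(_ [:: m] isT); rewrite big_seq1. Qed.

Lemma l1le_ge0 A B f : l1le A B f -> 0 <= B.
Proof. by move=> /(_ [::] isT); rewrite big_nil. Qed.

Lemma l1le_le A B B' f : B <= B' -> l1le A B f -> l1le A B' f.
Proof. by move=> BB fB s us; apply: le_trans BB; apply: fB. Qed.

Lemma l1le_dom A A' B f g :
  (forall m, v (g m) * wt A' m <= v (f m) * wt A m) -> l1le A B f -> l1le A' B g.
Proof.
by move=> fg fB s us; apply: le_trans (fB s us); apply: ler_sum.
Qed.

Lemma l1le_radius A A' B f : (forall i, 0 <= A' i <= A i) -> l1le A B f -> l1le A' B f.
Proof.
move=> AA; apply: l1le_dom => m.
by rewrite ler_wpM2l ?(av_ge0 v_abs) // le_wt.
Qed.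

Lemma l1le0 A : l1le A 0 0.
Proof. by move=> s _; rewrite big1 // => k _; rewrite mfps0E av0 ?mul0r. Qed.

Lemma l1leXm A m : (forall i, 0 <= A i) -> l1le A (wt A m) (mfpsXm K m).
Proof.
move=> A0 s us; have [ms|ms] := boolP (m \in s).
  have -> : wt A m = v (mfpsXm K m m) * wt A m + 0.
    by rewrite mfpsXmE eqxx (av1 v_abs) mul1r addr0.
  rewrite (bigD1_seq m ms us); apply: lerD => //; rewrite big1 // => k km.
  by rewrite mfpsXmE eq_sym (negPf km) av0 // mul0r.
rewrite big_seq big1 ?wt_ge0 // => k ks.
rewrite mfpsXmE; case: eqP => [E|_]; last by rewrite av0 // mul0r.
by rewrite E ks in ms.
Qed.

Lemma l1le1 A : (forall i, 0 <= A i) -> l1le A 1 1.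
Proof. by move=> A0; rewrite -(wt0 A) -mfpsXm0; apply: l1leXm. Qed.

Lemma l1leD A B B' f g : (forall i, 0 <= A i) ->
  l1le A B f -> l1le A B' g -> l1le A (B + B') (f + g).
Proof.
move=> A0 fB gB s us; apply: le_trans (lerD (fB s us) (gB s us)).
rewrite -big_split /=; apply: ler_sum => k _; rewrite -mulrDl.
by rewrite ler_wpM2r ?wt_ge0 // (av_add v_abs).
Qed.

Lemma l1leN A B f : l1le A B f -> l1le A B (- f).
Proof. by apply: l1le_dom => m; rewrite mfpsNE avN. Qed.

Lemma l1leZ A B a f : l1le A B f -> l1le A (v a * B) (a *: f).
Proof.
move=> fB s us.
apply: le_trans (ler_wpM2l (av_ge0 v_abs a) (fB s us)).
by rewrite mulr_sumr ler_sum // => k _; rewrite mfpsZE (av_mul v_abs) mulrA.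
Qed.

(** All factors of monomials in [s] have degree less than [d], and each pair of such factors
    contributes to at most one exponent of [s]; so the partial sum of the product is dominated by
    the product of two partial sums. *)
Lemma l1leM A B B' f g : (forall i, 0 <= A i) ->
  l1le A B f -> l1le A B' g -> l1le A (B * B') (f * g).
Proof.
move=> A0 fB gB s us; pose d := (\max_(k <- s) mdeg k).+1.
have sd k : k \in s -> (mdeg k < d)%N.
  by move=> ks; apply: (@leq_bigmax_seq _ s predT mdeg k ks isT).
have bd h C : l1le A C h -> \sum_(k : 'X_{1..n < d}) v (h k) * wt A k <= C.
  move=> hC; rewrite -(big_map (@bmnm n d) predT (fun k => v (h k) * wt A k)).
  by apply: hC; rewrite map_inj_uniq ?index_enum_uniq //; apply: val_inj.
pose a (k : 'X_{1..n < d}) := v (f k) * wt A k.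
pose b (k : 'X_{1..n < d}) := v (g k) * wt A k.
apply: (@le_trans _ _ (\sum_(k1 : 'X_{1..n < d}) \sum_(k2 : 'X_{1..n < d}) a k1 * b k2)).
  rewrite pair_bigA.
  apply: (@le_trans _ _ (\sum_(m <- s)
    \sum_(k : 'X_{1..n < d, d} | m == (k.1 + k.2)%MM) a k.1 * b k.2)).
    rewrite big_seq [leRHS]big_seq; apply: ler_sum => m ms.
    rewrite (mfpsM_wide f g (sd m ms)).
    apply: le_trans (ler_wpM2r (wt_ge0 _ A0) (av_sum v_abs _ _ _)) _.
    rewrite mulr_suml; apply: ler_sum => k /eqP ->.
    by rewrite (av_mul v_abs) wtD /a /b mulrACA.
  rewrite (exchange_big_dep xpredT) //=; apply: ler_sum => k _.
  have ab0 : 0 <= a k.1 * b k.2 by rewrite !mulr_ge0 ?(av_ge0 v_abs) ?wt_ge0.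
  have [ks|ks] := boolP ((k.1 + k.2)%MM \in s).
    by rewrite -big_filter filter_pred1_uniq // big_seq1.
  rewrite big_seq_cond big1 // => m /andP[ms /eqP mE].
  by rewrite mE (negPf ks) in ms.
under eq_bigr do rewrite -mulr_sumr.
rewrite -mulr_suml; apply: ler_pM; rewrite ?sumr_ge0 ?bd // => k _;
by rewrite mulr_ge0 ?(av_ge0 v_abs) ?wt_ge0.
Qed.

Lemma l1leX A B f i : (forall i, 0 <= A i) -> l1le A B f -> l1le A (B ^+ i) (f ^+ i).
Proof.
move=> A0 fB; elim: i => [|i IH]; first by rewrite !expr0; apply: l1le1.
by rewrite !exprS; apply: l1leM.
Qed.

Lemma l1le_sum (I : Type) (r : seq I) (P : pred I) A (B : I -> R) (f : I -> mfps n K) :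
  (forall i, 0 <= A i) -> (forall i, P i -> l1le A (B i) (f i)) ->
  l1le A (\sum_(i <- r | P i) B i) (\sum_(i <- r | P i) f i).
Proof.
move=> A0 fB; elim/big_rec2: _ => [|i x y Pi xy]; first exact: l1le0.
by apply: l1leD => //; apply: fB.
Qed.

(** Halving the radius turns a bound on the supremum into an l1-bound, at the cost of the sum of all
    powers of 1/2. *)
Lemma l1le_sup (a B : R) f : 0 < a -> (forall m, v (f m) * a ^+ mdeg m <= B) ->
  l1le (fun=> a / 2) (B * 2 ^+ n) f.
Proof.
move=> a0 fB s us.
have B0 : 0 <= B.
  by apply: le_trans (fB 0%MM); rewrite mulr_ge0 ?(av_ge0 v_abs) ?exprn_ge0 ?ltW.
apply: le_trans (ler_wpM2l B0 (sum_half_mdeg _ us)); rewrite mulr_sumr.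
apply: ler_sum => k _; rewrite wt_const exprMn mulrA.
by rewrite ler_wpM2r ?exprn_ge0 ?invr_ge0.
Qed.

Lemma convergentP f :
  reflect (exists A B : R, [/\ 0 < A, 0 < B & forall m, v (f m) * A ^+ mdeg m <= B])
    (f \in convergent v n).
Proof. exact: asboolP. Qed.

Lemma l1_convergent A B f : (forall i, 0 < A i) -> l1le A B f -> f \in convergent v n.
Proof.
move=> A0 fB; have [a [a0 aA]] : exists a, 0 < a /\ forall i, a <= A i.
  (* The default value 1 takes care of [n = 0]. *)
  exists (\big[Order.min/1]_i A i); split.
    by elim/big_rec: _ => // i x _ x0; rewrite lt_min A0.
  by move=> i; apply: bigmin_le_cond.
apply/convergentP; exists a, (B + 1); split=> //.
  by have := l1le_ge0 fB; lra.
move=> m; have /(l1le_coef m) : l1le (fun=> a) B f.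
  by apply: l1le_radius fB => i; rewrite aA ltW.
by rewrite wt_const; lra.
Qed.

(** Bounds are given for all smaller radii, so that several series can be brought to a common
    polydisc. *)
Lemma convergent_l1 f : f \in convergent v n ->
  exists2 a, 0 < a & forall a', 0 <= a' <= a -> exists2 B, 0 < B & l1le (fun=> a') B f.
Proof.
move=> /convergentP[A [B [A0 B0 fB]]]; exists (A / 2); first lra.
move=> a' aA; exists (B * 2 ^+ n); first by rewrite mulr_gt0 ?exprn_gt0.
by apply: l1le_radius (l1le_sup A0 fB).
Qed.

Lemma convergent_l1_seq (fs : seq (mfps n K)) :
  {subset fs <= convergent v n} ->
  exists a B, [/\ 0 < a, 0 < B & forall f, f \in fs -> l1le (fun=> a) B f].
Proof.
(* The induction carries all smaller radii along, since each new series may shrink the radius. *)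
move=> fsc; suff [a a0 aP] : exists2 a, 0 < a & forall a', 0 <= a' <= a ->
    exists2 B, 0 < B & forall f, f \in fs -> l1le (fun=> a') B f.
  by have [|B B0 BP] := aP a; [rewrite ltW //= | exists a, B].
elim: fs fsc => [_|f fs IH fsc]; first by exists 1 => // a' _; exists 1.
have [|a a0 aP] := IH; first by move=> g gs; apply: fsc; rewrite inE gs orbT.
have [b b0 bP] := convergent_l1 (fsc f (mem_head _ _)).
exists (Order.min a b); first by rewrite lt_min a0.
move=> c; rewrite le_min => /and3P[c0 ca cb].
have [|B B0 BP] := aP c; first by rewrite c0.
have [|C C0 CP] := bP c; first by rewrite c0.
exists (B + C); first exact: addr_gt0.
move=> g; rewrite inE => /orP[/eqP ->|gs].
  by apply: l1le_le CP; rewrite lerDr ltW.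
by apply: l1le_le (BP g gs); rewrite lerDl ltW.
Qed.

(** * Neumann series of an operator that raises the order with respect to [gr] *)

Section Neumann.
Variables (A : 'I_n -> R) (T : mfps n K -> mfps n K) (gr : 'X_{1..n} -> nat).
Hypothesis T_add : {morph T : f g / f + g}.
Hypothesis T_local : forall h s, (forall m, (gr m < s)%N -> h m = 0) ->
  forall m, (gr m <= s)%N -> T h m = 0.

(** A fixed point vanishes to every order, since [T] raises the order. *)
Lemma local_fixpoint0 h : h = T h -> h = 0.
Proof.
move=> hT; suff h0 s m : (gr m < s)%N -> h m = 0.
  by apply: mfpsP => m; apply: (h0 (gr m).+1).
elim: s m => // s IH m; rewrite ltnS => ms.
by rewrite hT (T_local (s := s)).
Qed.

(** The solution is [q], the sum of all [T^j g]. Where [gr] is less than [s], only the first [s]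
    terms contribute, which defines [q] coefficientwise; the norms decrease like [2^-1 ^+ j], whence
    the bound [2 * B]. *)
Lemma neumann g B : (forall i, 0 <= A i) ->
  (forall C h, l1le A C h -> l1le A (C / 2) (T h)) ->
  l1le A B g -> exists2 q, l1le A (2 * B) q & q - T q = g.
Proof.
move=> A0 T2 gB; pose t j := iter j T g.
have t0 j m : (gr m < j)%N -> t j m = 0.
  elim: j m => // j IH m; rewrite ltnS => mj.
  exact: (T_local (s := j)).
have [q qE] : exists q : mfps n K, forall s m, (gr m < s)%N -> q m = \sum_(j < s) t j m.
  exists (MFPS (fun m => \sum_(j < (gr m).+1) t j m)) => s m ms.
  rewrite /= (big_ord_widen s (fun j => t j m)) //.
  rewrite big_mkcond /=; apply: eq_bigr => j _; case: ifPn => //.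
  by rewrite -leqNgt => /t0.
have T_sum (r : seq nat) : T (\sum_(j <- r) t j) = \sum_(j <- r) t j.+1.
  have T0 : T 0 = 0 by apply: (addIr (T 0)); rewrite -T_add !add0r.
  by rewrite (big_morph T T_add T0).
exists q.
  move=> s us; pose N := (\max_(k <- s) gr k).+1.
  apply: (@le_trans _ _ (\sum_(j < N) \sum_(k <- s) v (t j k) * wt A k)).
    rewrite exchange_big /= big_seq [leRHS]big_seq; apply: ler_sum => k ks.
    rewrite (qE N); last exact: (@leq_bigmax_seq _ s predT gr k ks isT).
    by rewrite -mulr_suml ler_wpM2r ?wt_ge0 // (av_sum v_abs).
  have tB j : l1le A (B * 2^-1 ^+ j) (t j).
    elim: j => [|j IH]; first by rewrite expr0 mulr1.
    by rewrite exprSr mulrA; apply: T2.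
  apply: (@le_trans _ _ (\sum_(j < N) B * 2^-1 ^+ j)).
    by apply: ler_sum => j _; apply: tB.
  rewrite -mulr_sumr [2 * B]mulrC ler_wpM2l ?(l1le_ge0 gB) //.
  exact: sum_half_pow.
apply: mfpsP => m; rewrite mfpsDE mfpsNE.
(* At [m], the image of [q - p] under [T] vanishes because [T] raises the order; with [p] in place
   of [q] the difference telescopes to the term [t 0]. *)
pose p := \sum_(0 <= j < gr m) t j.
have -> : T q m = T p m.
  have -> : q = p + (q - p) by rewrite addrC subrK.
  rewrite T_add mfpsDE [X in _ + X](T_local (s := gr m)) ?addr0 // => l lm.
  by rewrite mfpsDE mfpsNE (qE (gr m)) // mfps_sumE big_mkord subrr.
by rewrite /p T_sum mfps_sumE (qE (gr m).+1) // big_ord_recl big_mkord addrK.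
Qed.

End Neumann.
End L1Norm.

(** * Units and Weierstrass division *)

Section PartialDegree.
Variables (n : nat) (P : pred 'I_n).
Implicit Types (k m : 'X_{1..n}).

Definition pdeg m : nat := (\sum_(i | P i) m i)%N.

Lemma pdegD k m : pdeg (k + m)%MM = (pdeg k + pdeg m)%N.
Proof. by rewrite /pdeg -big_split; apply: eq_bigr => i _; rewrite mnmDE. Qed.

Lemma pdegU_muln i j : ~~ P i -> pdeg (U_(i) *+ j)%MM = 0%N.
Proof.
move=> Pi; apply: big1 => l Pl; rewrite mulmnE mnm1E.
by case: eqP => [E|]; [rewrite E Pl in Pi | rewrite mul0n].
Qed.

Definition shrink (R : realType) (e : R) (A : 'I_n -> R) : 'I_n -> R :=
  fun i => if P i then e * A i else A i.

Lemma wt_shrink (R : realType) (e : R) A m :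
  wt (shrink e A) m = e ^+ pdeg m * wt A m.
Proof.
rewrite /pdeg (big_morph (fun i => e ^+ i) (exprD e) (expr0 e)) /wt.
rewrite [X in X * _]big_mkcond -big_split; apply: eq_bigr => i _; rewrite /shrink.
by case: (P i) => /=; rewrite ?exprMn ?mul1r.
Qed.

Lemma shrink_gt0 (R : realType) (e : R) A :
  0 < e -> (forall i, 0 < A i) -> forall i, 0 < shrink e A i.
Proof. by move=> e0 A0 i; rewrite /shrink; case: ifP => // _; rewrite mulr_gt0. Qed.

(** This supplies the order hypothesis of the Neumann series for operators built from a
    multiplication. *)
Lemma mul_local (K : comNzRingType) (h : mfps n K) :
  (forall k, h k != 0 -> (0 < pdeg k)%N) ->
  forall (f : mfps n K) s, (forall m, (pdeg m < s)%N -> f m = 0) ->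
  forall m, (pdeg m <= s)%N -> (h * f) m = 0.
Proof.
move=> h0 f s fs m ms; apply: mfpsM_eq0 => k l kl.
have [->|hk] := eqVneq (h k) 0; first by rewrite mul0r.
rewrite (fs l) ?mulr0 //; apply: leq_trans ms.
by rewrite -kl pdegD -addn1 addnC leq_add2r h0.
Qed.

End PartialDegree.

Section Unit.
Variables (R : realType) (K : fieldType) (v : K -> R).
Hypothesis v_abs : absolute_value v.
Variable n : nat.
Implicit Types (f g h : mfps n K).

(** Each term gains the factor [e ^+ pdeg P k], which is at most [e] because the exponent is
    positive on the support of [h]. *)
Lemma l1le_shrink (P : pred 'I_n) A B (e : R) h :
  (forall i, 0 <= A i) -> 0 <= e <= 1 ->
  (forall k, h k != 0 -> (0 < pdeg P k)%N) ->
  l1le v A B h -> l1le v (shrink P e A) (e * B) h.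
Proof.
move=> A0 /andP[e0 e1] h0 hB s us.
apply: le_trans (ler_wpM2l e0 (hB s us)); rewrite mulr_sumr.
apply: ler_sum => k _; rewrite wt_shrink.
have [->|hk] := eqVneq (h k) 0; first by rewrite av0 // !mul0r mulr0.
have -> : v (h k) * (e ^+ pdeg P k * wt A k) = e ^+ pdeg P k * (v (h k) * wt A k).
  by ring.
rewrite ler_wpM2r ?mulr_ge0 ?(av_ge0 v_abs) ?wt_ge0 //.
have := h0 _ hk; case: (pdeg P k) => // j _.
by rewrite exprS ler_piMr // exprn_ile1.
Qed.

Lemma convergent_subalg : GRing.subalg_closed (convergent v n).
Proof.
(* Each closure property is checked on one polydisc common to the finitely many series involved. *)
have conv (fs : seq (mfps n K)) f :
    (forall a B, 0 < a -> 0 < B -> (forall f, f \in fs -> l1le v (fun=> a) B f) ->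
      exists C, l1le v (fun=> a) C f) ->
    {subset fs <= convergent v n} -> f \in convergent v n.
  move=> fsf /(convergent_l1_seq v_abs)[a [B [a0 B0 fsB]]].
  have [C fC] := fsf a B a0 B0 fsB.
  by apply: l1_convergent fC.
split=> [|a f g fc gc|f g fc gc].
- apply: (conv [::]) => // a B a0 B0 _; exists 1; apply: l1le1 => // i.
  exact: ltW.
- apply: (conv [:: f; g]) => [b B b0 B0 fgB|h]; last by rewrite in_cons mem_seq1 => /orP[]/eqP ->.
  exists (v a * B + B); apply: l1leD => //; first by move=> i; apply: ltW.
    by apply: l1leZ => //; apply: fgB; rewrite mem_head.
  by apply: fgB; rewrite in_cons mem_seq1 eqxx orbT.
apply: (conv [:: f; g]) => [b B b0 B0 fgB|h]; last by rewrite in_cons mem_seq1 => /orP[]/eqP ->.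
exists (B * B); apply: l1leM => //; first by move=> i; apply: ltW.
  by apply: fgB; rewrite mem_head.
by apply: fgB; rewrite in_cons mem_seq1 eqxx orbT.
Qed.

Lemma convergent1 : 1 \in convergent v n.
Proof. by case: convergent_subalg. Qed.

Lemma convergent0 : 0 \in convergent v n.
Proof.
case: convergent_subalg => c1 cD _.
by rewrite -(addNr 1) -scaleN1r; apply: cD.
Qed.

Lemma convergentM f g :
  f \in convergent v n -> g \in convergent v n -> f * g \in convergent v n.
Proof. by case: convergent_subalg => _ _; apply. Qed.

Lemma convergentZ a f : f \in convergent v n -> a *: f \in convergent v n.
Proof.
case: convergent_subalg => c1 cD _ fc; rewrite -[_ *: _]addr0.
by apply: cD => //; apply: convergent0.
Qed.

Lemma convergentB f g :
  f \in convergent v n -> g \in convergent v n -> f - g \in convergent v n.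
Proof.
case: convergent_subalg => _ cD _ fc gc.
by rewrite addrC -scaleN1r; apply: cD.
Qed.

Lemma small_scale (B c : R) : 0 <= B -> 0 < c ->
  exists2 e : R, 0 < e <= 1 & e * B <= c.
Proof.
move=> B0 c0; exists (Order.min 1 (c / (B + 1))).
  by rewrite lt_min ltr01 divr_gt0 ?ge_min ?lexx //; lra.
have [|/ltW] := leP 1 (c / (B + 1)) => h.
  by rewrite mul1r; move: h; rewrite ler_pdivlMr; lra.
have -> : c / (B + 1) * B = c * (B / (B + 1)) by field; lra.
by rewrite ler_piMr ?(ltW c0) // ler_pdivrMr; lra.
Qed.

(** Dividing by the constant term gives [1 - h] with [h] of positive order. Its inverse is the
    Neumann series of multiplication by [h], which has norm at most 1/2 once all radii are
    shrunk. *)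
Lemma convergent_unit f : f \in convergent v n -> f 0%MM != 0 ->
  exists2 g, g \in convergent v n & f * g = 1.
Proof.
move=> fc f0; pose h := 1 - (f 0%MM)^-1 *: f.
have hc : h \in convergent v n by rewrite convergentB ?convergent1 ?convergentZ.
have h0 k : h k != 0 -> (0 < pdeg predT k)%N.
  rewrite /pdeg -mdegE lt0n mdeg_eq0; apply: contra => /eqP ->.
  by rewrite mfpsDE mfpsNE mfpsZE mfps1E eqxx mulVf // subrr.
have [a a0 aP] := convergent_l1 v_abs hc.
have [|B B0 hB] := aP a; first by rewrite lexx ltW.
have [e e01 eB] : exists2 e : R, 0 < e <= 1 & e * B <= 2^-1.
  by apply: small_scale; [rewrite ltW | rewrite invr_gt0].
have e0 : 0 < e by case/andP: e01.
have A0 : forall i, 0 < shrink predT e (fun _ : 'I_n => a) i by apply: shrink_gt0.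
have hB' : l1le v (shrink predT e (fun=> a)) 2^-1 h.
  apply: l1le_le eB _; apply: l1le_shrink => // [i|]; first exact: ltW.
  by rewrite ltW //; case/andP: e01.
have [||C u uC||q qB qE] := @neumann R K v v_abs n (shrink predT e (fun=> a))
    (fun q => h * q) (pdeg predT) _ _ 1 1 (fun i => ltW (A0 i)).
- by move=> x y; rewrite mulrDr.
- exact: mul_local.
- by rewrite mulrC; apply: l1leM => // i; apply: ltW.
- by apply: l1le1 => // i; apply: ltW.
exists ((f 0%MM)^-1 *: q); first by apply: convergentZ; apply: l1_convergent A0 qB.
by rewrite -qE -[X in _ = X - _]mul1r -mulrBl subKr -scalerAr scalerAl.
Qed.

End Unit.

(** * Exponents and series with a distinguished last variable *)

Section LastVariable.
Variables (n : nat).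
Implicit Types (m : 'X_{1..n.+1}) (l : 'X_{1..n}).
Local Notation widen := (widen_ord (leqnSn n)).

Lemma widen_ordP (i : 'I_n.+1) : i = ord_max \/ exists j, i = widen j.
Proof.
case: (unliftP ord_max i) => [j ->|->]; [right|by left].
by exists j; apply: val_inj; apply: lift_max.
Qed.

Lemma widen_neq_max (j : 'I_n) : (widen j == ord_max) = false.
Proof. by apply/eqP => /(congr1 val) /= E; have := ltn_ord j; rewrite E ltnn. Qed.

Definition mnmtrunc m : 'X_{1..n} := [multinom m (widen i) | i < n].
Definition mnmext l j : 'X_{1..n.+1} := (mnmwiden l + U_(ord_max) *+ j)%MM.

Lemma mnmext_max l j : mnmext l j ord_max = j.
Proof. by rewrite mnmDE mnmwiden_ordmax mulmnE mnm1E eqxx mul1n. Qed.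

Lemma mnmext_widen l j i : mnmext l j (widen i) = l i.
Proof.
by rewrite mnmDE mnmwiden_widen mulmnE mnm1E eq_sym widen_neq_max mul0n addn0.
Qed.

Lemma mnmtruncK m : mnmext (mnmtrunc m) (m ord_max) = m.
Proof.
apply/mnmP => i; have [->|[j ->]] := widen_ordP i; first by rewrite mnmext_max.
by rewrite mnmext_widen mnmE.
Qed.

Lemma mnmextK l j : mnmtrunc (mnmext l j) = l.
Proof. by apply/mnmP => i; rewrite mnmE mnmext_widen. Qed.

Lemma mdeg_ext l j : mdeg (mnmext l j) = (mdeg l + j)%N.
Proof.
rewrite mdegD mdegMn mdeg1 mul1n; congr (_ + _)%N.
rewrite !mdegE big_ord_recr /= mnmwiden_ordmax addn0.
by apply: eq_bigr => i _; rewrite mnmwiden_widen.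
Qed.

Lemma mnmext_addU l j d : (mnmext l j + U_(ord_max) *+ d)%MM = mnmext l (j + d).
Proof.
apply/mnmP => i; rewrite mnmDE mulmnE mnm1E.
have [->|[k ->]] := widen_ordP i; first by rewrite !mnmext_max eqxx mul1n.
by rewrite !mnmext_widen eq_sym widen_neq_max mul0n addn0.
Qed.

Variable K : comNzRingType.

Lemma widen_inj : injective widen.
Proof. by move=> i j /(congr1 val) /= ij; apply: val_inj. Qed.

Lemma mnm_rename_widen l : mnm_rename widen l = mnmext l 0.
Proof.
apply/mnmP => i; have [->|[j ->]] := widen_ordP i.
  by rewrite mnm_pushE mnmext_max big1 // => j _; rewrite mnm1E widen_neq_max mul0n.
by rewrite mnm_renameE ?mnmext_widen //; apply: widen_inj.
Qed.

Lemma mfps_inclE (f : mfps n K) m :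
  mfps_incl f m = if m ord_max == 0%N then f (mnmtrunc m) else 0.
Proof.
rewrite /mfps_incl -[in LHS](mnmtruncK m); case: eqP => [->|/eqP m0].
  by rewrite -mnm_rename_widen mfps_renameE //; apply: widen_inj.
apply: mfps_rename0 => k; rewrite mnm_rename_widen; apply: contra m0 => /eqP.
by move=> /(congr1 (fun k : 'X_{1..n.+1} => k ord_max)); rewrite !mnmext_max => <-.
Qed.

(** The coefficients of a polynomial in the last variable can be read off the series it defines;
    this will make the Weierstrass remainder unique. *)
Lemma horner_inclE (r : {poly mfps n K}) m :
  (map_poly (@mfps_incl n K) r).[mfpsX ord_max] m = r`_(m ord_max) (mnmtrunc m).
Proof.
rewrite /map_poly horner_poly mfps_sumE.
under eq_bigr => i _ do rewrite mfpsX_Xm -mfpsXm_muln mfpsMXm.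
have F0 (i : nat) : i != m ord_max ->
    (if (U_(ord_max) *+ i <= m)%MM then mfps_incl r`_i (m - U_(ord_max) *+ i)%MM
     else 0) = 0.
  move=> im; case: ifP => // /mnm_lepP/(_ ord_max); rewrite mulmnE mnm1E eqxx mul1n.
  move=> le_im; rewrite mfps_inclE mnmBE mulmnE mnm1E eqxx mul1n subn_eq0.
  by rewrite leqNgt ltn_neqAle im le_im.
have [lt_ms|ge_ms] := ltnP (m ord_max) (size r); last first.
  rewrite big1 => [|i _]; last first.
    by apply: F0; rewrite ltn_eqF // (leq_trans (ltn_ord i)).
  by rewrite nth_default.
rewrite (bigD1 (Ordinal lt_ms)) // big1 => [|i im]; last by apply: F0.
rewrite [LHS]addr0 ifT; last first.
  apply/mnm_lepP => i; rewrite mulmnE mnm1E; case: eqP => [<-|]; last by rewrite mul0n.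
  by rewrite mul1n.
rewrite mfps_inclE mnmBE mulmnE mnm1E eqxx mul1n subnn eqxx; congr (mfps_coeff _ _).
apply/mnmP => i; rewrite !mnmE mulmnE mnm1E eq_sym widen_neq_max mul0n.
by rewrite subn0.
Qed.

End LastVariable.

Section LastVariableShift.
Variables (n d : nat) (K : comNzRingType).
Implicit Types (f g : mfps n.+1 K) (m : 'X_{1..n.+1}).
Local Notation Ud := (U_(ord_max) *+ d)%MM.

(** [tau] and [low] are the quotient and the remainder in the division by the [d]-th power of the
    last variable. *)
Definition tau f : mfps n.+1 K := MFPS (fun m => f (m + Ud)%MM).
Definition low f : mfps n.+1 K := MFPS (fun m => if (m ord_max < d)%N then f m else 0).

Lemma tauE f m : tau f m = f (m + Ud)%MM. Proof. by []. Qed.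

Lemma tauD : {morph tau : f g / f + g}. Proof. by move=> f g; apply: mfpsP. Qed.
Lemma tauB : {morph tau : f g / f - g}. Proof. by move=> f g; apply: mfpsP. Qed.

Lemma Ud_le m : (Ud <= m)%MM = (d <= m ord_max)%N.
Proof.
apply/mnm_lepP/idP => [/(_ ord_max)|dm i]; rewrite mulmnE mnm1E ?eqxx ?mul1n //.
by case: eqP => [<-|]; rewrite ?mul1n.
Qed.

Lemma tau_low_dec f : f = tau f * mfpsXm K Ud + low f.
Proof.
apply: mfpsP => m; rewrite mfpsDE mfpsMXm Ud_le /= ltnNge.
by case: leqP => dm; rewrite ?addr0 ?add0r // submK // Ud_le.
Qed.

Lemma tauMXm f : tau (f * mfpsXm K Ud) = f.
Proof. by apply: mfpsP => m; rewrite tauE mfpsMXm_add. Qed.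

Lemma tau_eq0 f : tau f = 0 -> forall m, (d <= m ord_max)%N -> f m = 0.
Proof.
move=> /(congr1 (fun f : mfps n.+1 K => mfps_coeff f)) tf m dm.
rewrite -(@submK _ Ud m) ?Ud_le //.
by move/funeqP: tf => /(_ (m - Ud)%MM).
Qed.

End LastVariableShift.

Section WeierstrassDivision.
Variables (R : realType) (K : fieldType) (v : K -> R).
Hypothesis v_abs : absolute_value v.
Variables (n d : nat) (F G : mfps n.+1 K) (u : mfps 1 K).
Hypothesis F_conv : F \in convergent v n.+1.
Hypothesis G_conv : G \in convergent v n.+1.
Hypothesis Fu : mfps_subst (fun i => if i == ord_max then mfpsX ord0 else 0) F
  = mfpsX ord0 ^+ d * u.
Hypothesis u0 : u 0%MM != 0.
Local Notation lastU := (@mnm1 n.+1 ord_max).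
Local Notation tau := (@tau n d K).
Local Notation low := (@low n d K).
Local Notation xdeg := (pdeg (fun i : 'I_n.+1 => i != ord_max)).

Lemma xdeg0 m : xdeg m = 0%N -> m = (lastU *+ m ord_max)%MM.
Proof.
move=> /eqP; rewrite sum_nat_eq0 => /forallP m0.
apply/mnmP => i; rewrite mulmnE mnm1E eq_sym.
have [->|im] := eqVneq i ord_max; first by rewrite mul1n.
by have := m0 i; rewrite im => /eqP ->; rewrite mul0n.
Qed.

(** Among the exponents pushed to a given power of the single variable, only the one on the last
    axis avoids the variables that are set to 0. *)
Lemma F_axis j : F (lastU *+ j)%MM = (mfpsX ord0 ^+ d * u) (U_(ord0) *+ j)%MM.
Proof.
rewrite -Fu (@subst_monom_uniq _ _ _ (fun i => (i == ord_max)%:R) (fun=> U_(ord0)%MM)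
  _ _ _ F _ (lastU *+ j)%MM).
- rewrite big1 ?mulr1 // => i _; rewrite mulmnE mnm1E eq_sym.
  by case: eqP; rewrite ?expr1n // mul0n expr0.
- by move=> i; case: eqP; rewrite ?scale1r ?scale0r.
- by move=> i; rewrite mdeg1.
- apply/mnmP => i; rewrite mnm_pushE (bigD1 ord_max) //= big1.
    by rewrite !(mulmnE, mnm1E) eqxx mul1n addn0.
  by move=> l /negPf lm; rewrite !(mulmnE, mnm1E) [ord_max == l]eq_sym lm muln0.
move=> k /(congr1 mdeg); rewrite mdeg_push mdegMn mdeg1 mul1n => kj nk.
have [k0|] := posnP (xdeg k).
  case: nk; rewrite {1}(xdeg0 k0); congr (_ *+ _)%MM.
  rewrite -kj (eq_bigr (fun i => k i)) => [|i _]; last by rewrite mul1n.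
  rewrite (bigD1 ord_max) //= -[RHS]/(k ord_max + xdeg k)%N.
  by rewrite k0 addn0.
rewrite lt0n sum_nat_eq0 negb_forall => /existsP[i].
rewrite negb_imply => /andP[im ki]; rewrite (bigD1 i) //= (negPf im).
by rewrite expr0n (negPf ki) mul0r.
Qed.

Lemma F_axis_lt j : (j < d)%N -> F (lastU *+ j)%MM = 0.
Proof.
move=> jd; rewrite F_axis mfpsX_Xm -mfpsXm_muln mulrC mfpsMXm.
rewrite ifF //; apply/mnm_lepP => /(_ ord0).
by rewrite !mulmnE mnm1E eqxx !mul1n leqNgt jd.
Qed.

(** This constant term is the coefficient of degree [d] on the last axis, that is, [u 0]. *)
Lemma tauF0 : tau F 0%MM != 0.
Proof.
rewrite tauE add0m F_axis mfpsX_Xm -mfpsXm_muln mulrC mfpsMXm lepm_refl.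
suff -> : (U_(ord0) *+ d - U_(ord0) *+ d)%MM = 0%MM :> 'X_{1..1} by [].
by apply/mnmP => i; rewrite mnmBE subnn mnm0E.
Qed.

Lemma l1le_tau A B f : (forall i, 0 < A i) ->
  l1le v A B f -> l1le v A (B / A ord_max ^+ d) (tau f).
Proof.
move=> A0 fB s us; have A0d : 0 < A ord_max ^+ d by rewrite exprn_gt0.
rewrite ler_pdivlMr // mulr_suml.
have := fB [seq (m + lastU *+ d)%MM | m <- s].
rewrite map_inj_uniq => [/(_ us)|]; last exact: addIm.
rewrite big_map; apply: le_trans; apply: ler_sum => m _.
by rewrite tauE wtD wt_muln wtU mulrA.
Qed.

Lemma tau_convergent f : f \in convergent v n.+1 -> tau f \in convergent v n.+1.
Proof.
move=> /(convergent_l1 v_abs)[a a0 aP].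
have [|B B0 fB] := aP a; first by rewrite lexx ltW.
by apply: (l1_convergent v_abs _ (l1le_tau _ fB)).
Qed.

Lemma low_convergent f : f \in convergent v n.+1 -> low f \in convergent v n.+1.
Proof.
move=> /(convergent_l1 v_abs)[a a0 aP].
have [|B B0 fB] := aP a; first by rewrite lexx ltW.
apply: (l1_convergent v_abs (A := fun=> a)) => //.
apply: (l1le_dom _ fB) => m /=; case: ifP => // _.
by rewrite av0 // mul0r mulr_ge0 ?(av_ge0 v_abs) ?wt_ge0 // => i; rewrite ltW.
Qed.

(* With U = tau F a unit and V = low F, tau (F Q) = U Q + tau (V Q), so that
   Q' = U Q solves Q' + tau (V U^-1 Q') = tau G; the operator raises the degree
   in x', and is a contraction on polydiscs that are thin in the direction x'. *)
Lemma weierstrass_quotient : exists W Ui : mfps n.+1 K,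
  [/\ tau F * Ui = 1, Ui \in convergent v n.+1, W \in convergent v n.+1,
      forall k, W k != 0 -> (0 < xdeg k)%N &
      forall Q, tau (F * (Ui * Q)) = Q + tau (W * Q)].
Proof.
have [Ui Uic FUi] := convergent_unit v_abs (tau_convergent F_conv) tauF0.
exists (low F * Ui), Ui; split=> //.
- by apply: convergentM => //; apply: low_convergent.
(* A term of [low F] of degree 0 in x' lies on the last axis below [d], where [F] has no
   coefficient. *)
- move=> k; apply: contraR; rewrite -leqNgt leqn0 => /eqP k0.
  apply/eqP/mfpsM_eq0 => l l' lk; rewrite /low /=; case: ifP; rewrite ?mul0r // => ld.
  have l0 : xdeg l = 0%N by apply/eqP; rewrite -leqn0 -k0 -lk pdegD leq_addr.
  by rewrite (xdeg0 l0) F_axis_lt ?mul0r.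
move=> Q; rewrite {1}(tau_low_dec d F) mulrDl tauD; congr (_ + tau _).
  rewrite mulrAC tauMXm mulrA FUi mul1r //.
by rewrite mulrA.
Qed.

(** The vanishing of [tau (G - F * Q)] says that the remainder has degree less than [d] in the last
    variable. Uniqueness comes from the order alone and holds among all formal series; existence
    needs the contraction. *)
Lemma weierstrass_exists_unique :
  (exists2 Q, Q \in convergent v n.+1 & tau (G - F * Q) = 0) /\
  (forall Q, tau (F * Q) = 0 -> Q = 0).
Proof.
have [W [Ui [FUi Uic Wc W0 FQ]]] := weierstrass_quotient.
pose T (Q : mfps n.+1 K) : mfps n.+1 K := - tau (W * Q).
have T_add : {morph T : f g / f + g} by move=> f g; rewrite /T mulrDr tauD opprD.
have T_local (h : mfps n.+1 K) s : (forall m, (xdeg m < s)%N -> h m = 0) ->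
    forall m, (xdeg m <= s)%N -> T h m = 0.
  move=> hs m ms; rewrite mfpsNE tauE (mul_local W0 hs) ?oppr0 //.
  by rewrite pdegD pdegU_muln ?negbK // addn0.
split; last first.
  (* The series [tau F * Q] is a fixed point of [T], hence 0, and [Ui] recovers [Q] from it. *)
  move=> Q FQ0; have UFQ : Q = Ui * (tau F * Q) by rewrite mulrA [Ui * _]mulrC FUi mul1r.
  rewrite UFQ (@local_fixpoint0 _ _ T xdeg T_local (tau F * Q)) ?mulr0 //.
  apply/eqP; rewrite /T eq_sym -subr_eq0 -opprD addrC oppr_eq0 -FQ -UFQ.
  exact/eqP.
have [a [B [a0 B0 WGB]]] : exists a B, [/\ 0 < a, 0 < B &
    forall f, f \in [:: W; tau G] -> l1le v (fun=> a) B f].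
  apply: convergent_l1_seq => // f; rewrite in_cons mem_seq1.
  by case/orP => /eqP -> //; apply: tau_convergent.
have WB : l1le v (fun=> a) B W by apply: WGB; rewrite mem_head.
have GB : l1le v (fun=> a) B (tau G) by apply: WGB; rewrite in_cons mem_seq1 eqxx orbT.
have ad0 : 0 < a ^+ d by rewrite exprn_gt0.
(* The bound [a ^+ d / 2] compensates for the division by [A ord_max ^+ d] in [l1le_tau]; the last
   radius stays equal to [a], since only those of x' are shrunk. *)
have [e /andP[e0 e1] eB] : exists2 e : R, 0 < e <= 1 & e * B <= a ^+ d / 2.
  by apply: small_scale; [rewrite ltW | rewrite divr_gt0].
pose A := shrink (fun i : 'I_n.+1 => i != ord_max) e (fun=> a).
have A0 i : 0 < A i by apply: shrink_gt0.
have Amax : A ord_max = a by rewrite /A /shrink eqxx.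
have [||Q QB QE] := @neumann R K v v_abs _ A T xdeg T_add T_local (tau G) B
    (fun i => ltW (A0 i)) _ _.
- move=> C h hC; apply: l1leN => //.
  have -> : C / 2 = (a ^+ d / 2 * C) / A ord_max ^+ d.
    by rewrite Amax; field; rewrite lt0r_neq0.
  apply: l1le_tau => //; apply: l1leM => //; first by move=> i; apply: ltW.
  apply: l1le_le eB _; apply: l1le_shrink => // [i|]; first exact: ltW.
  by rewrite ltW.
- apply: l1le_radius GB => // i; rewrite ltW //= /A /shrink; case: ifP => // _.
  by rewrite ler_piMl // ltW.
exists (Ui * Q); first by apply: convergentM => //; apply: l1_convergent A0 QB.
by rewrite tauB FQ -QE /T opprK subrr.
Qed.

(** This is [low f], read as a polynomial in the last variable over the series in x'. *)
Definition low_poly (f : mfps n.+1 K) : {poly mfps n K} :=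
  \poly_(j < d) (MFPS (fun l => f (mnmext l j)) : mfps n K).

Lemma low_poly_convergent f : f \in convergent v n.+1 ->
  low_poly f \is a polyOver (convergent v n).
Proof.
move=> /(convergentP)[a [B [a0 B0 fB]]].
apply/allP => r /(nthP 0)[j jd <-]; rewrite /low_poly coef_poly; case: ifP => _; last first.
  exact: convergent0.
apply/convergentP; exists a, (B / a ^+ j); split=> //; first by rewrite divr_gt0 ?exprn_gt0.
move=> l /=; rewrite ler_pdivlMr ?exprn_gt0 // -mulrA -exprD.
by have := fB (mnmext l j); rewrite mdeg_ext.
Qed.

Lemma weierstrass_division_convergent :
  exists! qr : mfps n.+1 K * {poly mfps n K},
    [/\ qr.1 \in convergent v n.+1, qr.2 \is a polyOver (convergent v n),
        (size qr.2 <= d)%N &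
        G = F * qr.1 + (map_poly (@mfps_incl n K) qr.2).[mfpsX ord_max]].
Proof.
have [[Q Qc QE] QU] := weierstrass_exists_unique.
(* The quotient determines the remainder. *)
have rE (q : mfps n.+1 K) (r : {poly mfps n K}) :
    G = F * q + (map_poly (@mfps_incl n K) r).[mfpsX ord_max] ->
    forall j l, r`_j l = (G - F * q) (mnmext l j).
  move=> Gqr j l; rewrite [in RHS]Gqr addrAC subrr add0r horner_inclE.
  by rewrite mnmext_max mnmextK.
exists (Q, low_poly (G - F * Q)); split => /=.
  split=> //; first exact/low_poly_convergent/convergentB/convergentM.
    exact: size_poly.
  apply: mfpsP => m; rewrite mfpsDE horner_inclE coef_poly.
  have -> : G m = (F * Q) m + (G - F * Q) m by rewrite mfpsDE mfpsNE addrC subrK.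
  congr (_ + _); case: ltnP => md; last by rewrite (tau_eq0 QE).
  by rewrite -[RHS]/((G - F * Q) (mnmext _ _)) mnmtruncK.
move=> [q r] /= [qc rc rd Gqr].
have tau_q : tau (G - F * q) = 0.
  apply: mfpsP => m; rewrite tauE -(mnmtruncK m) mnmext_addU -(rE q r Gqr).
  by rewrite nth_default // (leq_trans rd) // leq_addl.
have Qq : Q = q.
  apply/eqP; rewrite -subr_eq0; apply/eqP/QU.
  have -> : F * (Q - q) = (G - F * q) - (G - F * Q) by ring.
  by rewrite tauB tau_q QE subrr.
congr (_, _) => //; apply/polyP => j; apply: mfpsP => l.
rewrite (rE q r Gqr) Qq coef_poly; case: ltnP => jd //.
by rewrite -(rE q r Gqr) nth_default // (leq_trans rd).
Qed.

End WeierstrassDivision.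

(** * The Weierstrass family of convergent series *)

Section ConvergentFamily.
Variables (R : realType) (K : fieldType) (v : K -> R).
Hypothesis v_abs : absolute_value v.

Lemma convergent_rename n p (s : 'I_n -> 'I_p) (f : mfps n K) : injective s ->
  (mfps_rename s f \in convergent v p) = (f \in convergent v n).
Proof.
move=> s_inj; apply/convergentP/convergentP => -[A [B [A0 B0 fB]]]; exists A, B; split=> // m.
  by have := fB (mnm_rename s m); rewrite mfps_renameE // mdeg_rename.
have [[k <-]|nk] := pselect (exists k, mnm_rename s k = m).
  by rewrite mfps_renameE // mdeg_rename.
rewrite mfps_rename0 ?av0 // ?mul0r ?ltW // => k.
by apply/eqP => km; apply: nk; exists k.
Qed.

Lemma convergent_mpoly n (p : {mpoly K[n]}) : mfps_of_mpoly p \in convergent v n.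
Proof.
apply/convergentP; exists 1, (\sum_(m <- msupp p) v p@_m + 1).
have S0 : 0 <= \sum_(m <- msupp p) v p@_m by rewrite sumr_ge0 // => m _; apply: av_ge0.
split=> // [|m]; first by lra.
rewrite expr1n mulr1 /=; have [pm|/memN_msupp_eq0 ->] := boolP (m \in msupp p).
  rewrite (bigD1_seq m) //= -addrA lerDl addr_ge0 //.
  by rewrite sumr_ge0 // => k _; apply: av_ge0.
by rewrite av0 //; lra.
Qed.

Lemma convergent_weierstrass : [pchar K] =i pred0 -> Weierstrass_family (convergent v).
Proof.
move=> char0; split=> //.
- by move=> n; apply: convergent_subalg.
- exact: convergent_mpoly.
- by move=> n m f; apply: convergent_rename; apply: lshift_inj.
- by move=> n s f fc; rewrite convergent_rename //; apply: perm_inj.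
- by move=> n f; apply: convergent_unit.
move=> n d F G u; exact: weierstrass_division_convergent.
Qed.

(** * Condition (a): blow-ups *)

Section Blowup.
Variable n : nat.
Implicit Types (k : 'X_{1..n.+2}).

Definition blowup_exp (i : 'I_n.+2) : 'X_{1..n.+2} :=
  if i == ord_max then (U_(ord0) + U_(ord_max))%MM else U_(i)%MM.

Lemma mnm_push_blowup k : mnm_push blowup_exp k = (k + U_(ord0) *+ k ord_max)%MM.
Proof.
apply/mnmP => j; rewrite mnm_pushE mnmDE mulmnE mnm1E.
have -> : (k j + (ord0 == j) * k ord_max =
    \sum_(i < n.+2) (i == j) * k i + \sum_(i < n.+2) (i == ord_max) * ((ord0 == j) * k i))%N.
  congr (_ + _)%N.
    rewrite (bigD1 j) //= eqxx mul1n big1 ?addn0 // => i /negPf ->.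
    by rewrite mul0n.
  rewrite (bigD1 ord_max) //= eqxx mul1n big1 ?addn0 // => i /negPf ->.
  by rewrite mul0n.
rewrite -big_split; apply: eq_bigr => i _; rewrite /blowup_exp /=.
have [->|im] := eqVneq i ord_max; rewrite ?mnmDE !mnm1E.
  by rewrite mul1n mulnDl addnC.
by rewrite mul0n addn0.
Qed.

Lemma mnm_push_blowup_inj : injective (mnm_push blowup_exp).
Proof.
move=> k l; rewrite !mnm_push_blowup => kl.
have klm : k ord_max = l ord_max.
  have /mnmP/(_ ord_max) := kl.
  by rewrite !(mnmDE, mulmnE, mnm1E) !mul0n !addn0.
by move: kl; rewrite klm => /addIm.
Qed.

(** The substitution moves the coefficients injectively and at most doubles the degree of an
    exponent. So a radius [a], taken at most 1, for the image gives the radius [a ^+ 2] for [f]. *)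
Lemma convergent_blowup (f : mfps n.+2 K) :
  mfps_subst (fun i => if i == ord_max then mfpsX ord0 * mfpsX ord_max else mfpsX i) f
    \in convergent v n.+2 ->
  f \in convergent v n.+2.
Proof.
move=> /convergentP[A [B [A0 B0 fB]]].
pose a := Order.min A 1; have a0 : 0 < a by rewrite lt_min A0 ltr01.
have [aA a1] : a <= A /\ a <= 1 by rewrite !ge_min !lexx orbT.
apply/convergentP; exists (a ^+ 2), B; split; rewrite ?exprn_gt0 // => k.
have := fB (mnm_push blowup_exp k).
rewrite (@subst_monom_uniq _ _ _ (fun=> 1) blowup_exp _ _ _ f _ k) //.
- rewrite [\prod_(i < _) _]big1 => [|i _]; last by rewrite expr1n.
  rewrite mulr1; apply: le_trans; rewrite ler_wpM2l ?(av_ge0 v_abs) //.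
  rewrite -exprM; apply: (@le_trans _ _ (a ^+ mdeg (mnm_push blowup_exp k))).
    apply: ler_wiXn2l => //; first exact: ltW.
    rewrite mnm_push_blowup mdegD mdegMn mdeg1 !mul1n mul2n -addnn leq_add2l.
    exact: leq_mdeg.
  by rewrite lerXn2r // nnegrE ltW.
- move=> i; rewrite scale1r /blowup_exp; case: ifP => // _.
  by rewrite mfpsXmD.
- by move=> i; rewrite /blowup_exp; case: ifP; rewrite ?mdegD !mdeg1.
by move=> l /mnm_push_blowup_inj.
Qed.

End Blowup.
End ConvergentFamily.

(** * Baire's theorem over a complete valued field *)

Section Baire.
Variables (R : realType) (K : fieldType) (v : K -> R).
Hypothesis v_abs : absolute_value v.
Hypothesis v_nontrivial : nontrivial_absolute_value v.
Hypothesis v_complete : complete_absolute_value v.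

Lemma av_small (e : R) : 0 < e -> exists2 x, x != 0 & v x < e.
Proof.
move=> e0; have [y y0 y1] : exists2 y, y != 0 & v y < 1.
  have [x x0 x1] := v_nontrivial.
  have [xl|xg|xe] := ltgtP (v x) 1; first by exists x.
    by exists x^-1; [rewrite invr_eq0 | rewrite avV // invf_lt1 // av_gt0].
  by rewrite xe eqxx in x1.
have vy := av_gt0 v_abs y0.
pose N := Num.bound ((e * (1 - v y))^-1).
have d0 : 0 < e * (1 - v y) by rewrite mulr_gt0 // subr_gt0.
(* A Bernoulli-type inequality, by which the powers of [v y] tend to 0. *)
have bern k : v y ^+ k * (1 + k%:R * (1 - v y)) <= 1.
  elim: k => [|k IH]; first by rewrite expr0; lra.
  apply: le_trans IH; rewrite exprS -mulrA mulrCA ler_wpM2l ?exprn_ge0 ?(av_ge0 v_abs) //.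
  rewrite -subr_ge0 -natr1.
  have -> : 1 + k%:R * (1 - v y) - v y * (1 + (k%:R + 1) * (1 - v y)) =
      (k%:R + 1) * (1 - v y) ^+ 2 by ring.
  by rewrite mulr_ge0 ?sqr_ge0 // addr_ge0.
exists (y ^+ N); first by rewrite expf_neq0.
rewrite avX //.
have NE : 1 < e * (1 - v y) * N%:R.
  rewrite mulrC -ltr_pdivrMr // mul1r.
  by apply: le_lt_trans (archi_boundP _); rewrite ?ler_norm // invr_ge0 ltW.
have vN : 0 < v y ^+ N by rewrite exprn_gt0.
have := bern N; nra.
Qed.

(** Each step finds, inside a given ball, a ball of at most half the radius contained in [U i]. The
    centres form a Cauchy sequence, and its limit lies in all these closed balls. *)
Lemma baire (U : nat -> K -> Prop) :
  (forall i a r, 0 < r -> exists b s, [/\ 0 < s, s <= r / 2 &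
     forall x, v (x - b) <= s -> v (x - a) <= r /\ U i x]) ->
  exists x, forall i, U i x.
Proof.
move=> step.
have next_ex (i : nat) (br : K * {r : R | 0 < r}) : exists bs : K * {r : R | 0 < r},
    sval bs.2 <= sval br.2 / 2 /\
    forall x, v (x - bs.1) <= sval bs.2 -> v (x - br.1) <= sval br.2 /\ U i x.
  have [b [s [s0 sr bs]]] := step i br.1 _ (svalP br.2).
  by exists (b, exist _ s s0).
pose next i br := sval (cid (next_ex i br)).
have nextP i br := svalP (cid (next_ex i br)).
pose fix seqb i := if i is j.+1 then next j (seqb j) else (0, exist _ 1 ltr01 : {r : R | 0 < r}).
pose b i := (seqb i).1; pose r i := sval (seqb i).2.
have r0 i : 0 < r i := svalP (seqb i).2.
have rS i : r i.+1 <= r i / 2 by have [] := nextP i (seqb i).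
have bS i x : v (x - b i.+1) <= r i.+1 -> v (x - b i) <= r i /\ U i x.
  by have [_] := nextP i (seqb i); apply.
have bij i j x : (i <= j)%N -> v (x - b j) <= r j -> v (x - b i) <= r i.
  move=> /subnK <-; elim: (j - i)%N => // k IH; rewrite addSn => /bS[xk _].
  exact: IH.
have bij2 i j : (i <= j)%N -> v (b j - b i) <= r i.
  by move=> ij; apply: (bij i j) => //; rewrite subrr av0 // ltW.
have rhalf i : r i <= 2^-1 ^+ i.
  elim: i => [|i IH]; first by rewrite expr0.
  by rewrite exprSr; apply: le_trans (rS i) _; rewrite ler_wpM2r // invr_ge0.
have rsmall e : 0 < e -> exists i, r i < e.
  move=> e0; exists (Num.bound e^-1).
  apply: (@le_lt_trans _ _ (2^-1 ^+ Num.bound e^-1)) => //.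
  rewrite exprVn -[ltRHS]invrK ltf_pV2 ?posrE ?invr_gt0 ?exprn_gt0 //.
  apply: (@lt_trans _ _ (Num.bound e^-1)%:R).
    by apply: archi_boundP; rewrite invr_ge0 ltW.
  by rewrite -natrX ltr_nat ltn_expl.
have [|l lP] := v_complete (u := b).
  move=> e e0; have [|N Ne] := rsmall (e / 2); first by rewrite divr_gt0.
  exists N => i j Ni Nj; have -> : b i - b j = (b i - b N) - (b j - b N) by ring.
  apply: le_lt_trans (avB v_abs _ _) _.
  by have := bij2 _ _ Ni; have := bij2 _ _ Nj; lra.
exists l => i; have [] := bS i l; last by [].
apply/ler_addgt0Pr => e e0; have [N NP] := lP e e0.
have -> : l - b i.+1 = (b (maxn N i.+1) - b i.+1) - (b (maxn N i.+1) - l) by ring.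
apply: le_trans (avB v_abs _ _) _; apply: lerD; first by rewrite bij2 ?leq_maxr.
by rewrite ltW // NP ?leq_maxl.
Qed.

(** When [c] is the centre of the ball, the new centre is moved by a small nonzero element, which
    exists because [v] is nontrivial; otherwise shrinking the ball is enough. *)
Lemma avoid_point (c a : K) (r : R) : 0 < r -> exists b s, [/\ 0 < s, s <= r / 2 &
  forall x, v (x - b) <= s -> v (x - a) <= r /\ x <> c].
Proof.
move=> r0; have [ac|ac] := eqVneq a c; last first.
  have vac : 0 < v (a - c) by rewrite av_gt0 // subr_eq0.
  exists a, (Order.min (r / 2) (v (a - c) / 2)); split=> [||x].
  - by rewrite lt_min !divr_gt0.
  - by rewrite ge_min lexx.
  rewrite le_min => /andP[x1 x2]; split; first lra.
  move=> xc; move: x2; rewrite xc -(avN v_abs) opprB; lra.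
have [|z z0 zr] := @av_small (r / 2); first by rewrite divr_gt0.
have vz := av_gt0 v_abs z0.
exists (a + z), (v z / 2); split=> [||x xz]; [lra|lra|split].
  have -> : x - a = (x - (a + z)) + z by ring.
  by apply: le_trans (av_add v_abs _ _) _; lra.
move=> xc; move: xz; rewrite xc -ac opprD addrA subrr add0r avN //; lra.
Qed.

Lemma countable_enum (A : set K) : countable A ->
  exists c : nat -> K, forall x, A x -> exists i, c i = x.
Proof.
move=> /countable_injP[f f_inj].
(* Indices outside the image of [f] get the default 0: the enumeration covers [A] but may leave
   it. *)
exists (fun i => if pselect (exists2 y, A y & f y = i) is left e then sval (cid2 e) else 0).
move=> x Ax; exists (f x); case: pselect => [e|]; last by case; exists x.
have [Ay fy] := (svalP (cid2 e), s2valP' (cid2 e)).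
by apply: f_inj; rewrite ?inE //; case: cid2.
Qed.

Lemma av_uncountable : ~ countable [set: K].
Proof.
move=> /countable_enum[c cP].
have [|x xc] := @baire (fun i x => x <> c i).
  by move=> i a r; apply: avoid_point.
by have [i] := cP x I; apply: nesym.
Qed.

Lemma horner_continuous (p : {poly K}) x e : 0 < e -> exists2 d, 0 < d &
  forall y, v (y - x) <= d -> v (p.[y] - p.[x]) < e.
Proof.
elim/poly_ind: p e => [|p c IH] e e0.
  by exists 1 => // y _; rewrite !horner0 subrr av0.
have px0 := av_ge0 v_abs p.[x]; have x0 := av_ge0 v_abs x.
have [|d1 d10 d1P] := IH (e / 2 / (v x + 1)); first by rewrite !divr_gt0 //; lra.
exists (Order.min d1 (Order.min 1 (e / 4 / (v p.[x] + 1)))).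
  by rewrite !lt_min d10 ltr01 !divr_gt0 //; lra.
move=> y; rewrite !le_min => /and3P[y1 y2 y3]; rewrite !hornerMXaddC.
have -> : p.[y] * y + c - (p.[x] * x + c) = (p.[y] - p.[x]) * y + p.[x] * (y - x) by ring.
apply: le_lt_trans (av_add v_abs _ _) _; rewrite !(av_mul v_abs).
have vy : v y <= v x + 1.
  have -> : y = x + (y - x) by ring.
  by apply: le_trans (av_add v_abs _ _) _; lra.
have h1 : v (p.[y] - p.[x]) * v y <= e / 2.
  have -> : e / 2 = e / 2 / (v x + 1) * (v x + 1) by field; lra.
  by apply: ler_pM; rewrite ?(av_ge0 v_abs) // ltW // d1P.
have h2 : v p.[x] * v (y - x) <= e / 4.
  have -> : e / 4 = (v p.[x] + 1) * (e / 4 / (v p.[x] + 1)) by field; lra.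
  by apply: ler_pM; rewrite ?(av_ge0 v_abs) //; lra.
lra.
Qed.

End Baire.

(** * Cauchy estimates and slices *)

Section CauchyEstimate.
Variables (R : realType) (K : fieldType) (v : K -> R).
Hypothesis v_abs : absolute_value v.
Hypothesis v_nontrivial : nontrivial_absolute_value v.
Hypothesis char0 : [pchar K] =i pred0.
Hypothesis K_closed : GRing.closed_field_axiom K.

Lemma two_neq0 : 2 != 0 :> K.
Proof. by have /pcharf0P -> := char0. Qed.

Lemma closed_sqrt (y : K) : exists x, x ^+ 2 = y.
Proof.
have [x xE] := K_closed (n := 2) (fun i => if i == 0%N then y else 0) isT.
by exists x; rewrite xE !big_ord_recl big_ord0 /= expr0 mulr1 mul0r !addr0.
Qed.

(* Halving the degree replaces the discrete Fourier transform: the even and odd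
   parts of p at x^2 are (p(x) + p(-x)) / 2 and (p(x) - p(-x)) / 2x. *)
Lemma cauchy_circle (C := 2 / v 2) j (p : {poly K}) (M r : R) :
  0 < r -> (exists x, v x = r) -> (size p <= 2 ^ j)%N ->
  (forall x, v x = r -> v p.[x] <= M) ->
  forall k, v p`_k * r ^+ k <= M * C ^+ j.
Proof.
have v2 : 0 < v 2 by rewrite av_gt0 // two_neq0.
elim: j p M r => [|j IH] p M r r0 [x0 x0r] sp pM k.
  (* A point on the circle is what makes [M] nonnegative. *)
  have M0 : 0 <= M by apply: le_trans (pM _ x0r); apply: av_ge0.
  rewrite expr0 mulr1; have pc := size1_polyC sp.
  case: k => [|k]; last by rewrite pc coefC av0 // mul0r.
  by rewrite expr0 mulr1; have := pM _ x0r; rewrite {1}pc hornerC.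
have pE x : p.[x] = (even_poly p).[x ^+ 2] + (odd_poly p).[x ^+ 2] * x.
  by rewrite -{1}(poly_even_odd p) hornerD hornerMX !horner_comp hornerXn.
have C0 : 0 < C by rewrite divr_gt0.
have half y z : y *+ 2 = z -> v y = v z / v 2.
  move=> <-; have -> : y *+ 2 = 2 * y by rewrite mulr_natl.
  by rewrite (av_mul v_abs) mulrC mulKf // gt_eqF.
have twice x : v x = r -> v p.[x] <= M /\ v p.[- x] <= M.
  by move=> xr; split; apply: pM; rewrite // avN.
have r20 : 0 < r ^+ 2 by rewrite exprn_gt0.
have r2x : exists x, v x = r ^+ 2 by exists (x0 ^+ 2); rewrite avX // x0r.
have sph : (uphalf (size p) <= 2 ^ j)%N by move: sp; rewrite expnS; lia.
(* As [K] is closed under square roots, squaring maps the circle of radius [r] onto that of radius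
   [r ^+ 2], so the even and odd parts are bounded on the whole larger-index circle. *)
have sqrtP y : v y = r ^+ 2 -> exists2 x, v x = r & x ^+ 2 = y.
  have [x <- xr] := closed_sqrt y; exists x => //.
  by apply/eqP; rewrite -(@eqrXn2 _ 2) ?(av_ge0 v_abs) ?ltW // -avX // xr.
have evenB y : v y = r ^+ 2 -> v (even_poly p).[y] <= C * M.
  move=> /sqrtP[x xr <-]; have [p1 p2] := twice x xr.
  rewrite (half _ (p.[x] + p.[- x])); last first.
    by rewrite !pE sqrrN mulrN mulr2n; ring.
  rewrite /C mulrAC ler_wpM2r ?invr_ge0 ?(ltW v2) //.
  by apply: le_trans (av_add v_abs _ _) _; lra.
have oddB y : v y = r ^+ 2 -> v (odd_poly p).[y] <= C * M / r.
  move=> /sqrtP[x xr <-]; have [p1 p2] := twice x xr.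
  rewrite ler_pdivlMr // -[in leLHS]xr -(av_mul v_abs).
  rewrite (half _ (p.[x] - p.[- x])); last first.
    by rewrite !pE sqrrN mulrN mulr2n; ring.
  rewrite /C mulrAC ler_wpM2r ?invr_ge0 ?(ltW v2) //.
  by apply: le_trans (avB v_abs _ _) _; lra.
have := odd_double_half k; case: (odd k) => <- /=; last first.
  have := IH _ _ _ r20 r2x (leq_trans (size_even_poly p) sph) evenB k./2.
  have -> : M * C ^+ j.+1 = C * M * C ^+ j by rewrite exprS mulrCA mulrA.
  by rewrite coef_even_poly -exprM mul2n.
have so : (size (odd_poly p) <= 2 ^ j)%N.
  apply: leq_trans (size_odd_poly p) (leq_trans _ sph).
  by rewrite uphalf_half leq_addl.
have := IH _ _ _ r20 r2x so oddB k./2.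
rewrite coef_odd_poly -exprM mul2n add1n [r ^+ _.+1]exprSr mulrA => h.
rewrite -ler_pdivlMr //; apply: le_trans h _.
by rewrite exprS le_eqVlt; apply/orP; left; apply/eqP; ring.
Qed.

(** The circle estimate around [a] bounds the coefficients of p(X + a), hence [p] on the unit
    circle, where the circle estimate applies again. It is used with [j = d], as d + 1 is at most
    [2 ^ d], so the loss is exponential in [d]. *)
Lemma cauchy_ball (a : K) (r : R) : 0 < r -> exists2 E : R, 0 < E &
  forall (d : nat) (p : {poly K}) (M : R), (size p <= d.+1)%N ->
    (forall x, v (x - a) <= r -> v p.[x] <= M) -> forall k, v p`_k <= M * E ^+ d.
Proof.
move=> r0; have [z z0 zr] := av_small v_abs v_nontrivial r0.
have v2 : 0 < v 2 by rewrite av_gt0 // two_neq0.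
have vz := av_gt0 v_abs z0; have va := av_ge0 v_abs a.
have C0 : 0 < 2 / v 2 by rewrite divr_gt0.
have := @cauchy_circle; move: (2 / v 2) C0 => C C0 circle.
(* [D] bounds |x - a| / |z| on the unit circle. In the constant below, the factor 2 absorbs the d +
   1 terms and each [C] one use of the circle estimate. *)
pose D : R := Order.max 1 ((1 + v a) / v z).
have D1 : 1 <= D by rewrite le_max lexx.
have D2 : (1 + v a) / v z <= D by rewrite le_max lexx orbT.
have D0 : 0 < D by lra.
exists (C * D * 2 * C); first by apply: mulr_gt0 => //; rewrite pmulr_lgt0 // mulr_gt0.
move=> d p M sp pM.
have M0 : 0 <= M.
  by apply: le_trans (pM a _); rewrite ?(av_ge0 v_abs) // subrr av0 // ltW.
have d2 : (d.+1 <= 2 ^ d)%N by rewrite ltn_expl.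
pose q := p \Po ('X + a%:P).
have qE x : q.[x] = p.[x + a] by rewrite horner_comp !hornerE.
have sq : (size q <= d.+1)%N by rewrite size_comp_poly2 // size_XaddC.
have qB k : v q`_k * v z ^+ k <= M * C ^+ d.
  apply: circle => //; [by exists z|exact: leq_trans d2|].
  by move=> x xz; rewrite qE pM // addrK xz ltW.
have pB x : v x = 1 -> v p.[x] <= M * (C * D * 2) ^+ d.
  move=> x1; have -> : p.[x] = q.[x - a] by rewrite qE subrK.
  rewrite (horner_coef_wide _ sq); apply: le_trans (av_sum v_abs _ _ _) _.
  apply: (@le_trans _ _ (\sum_(i < d.+1) M * C ^+ d * D ^+ d)); last first.
    rewrite sumr_const card_ord -[leLHS]mulr_natr [_ ^+ d in leRHS]exprMn.
    rewrite [(C * D) ^+ d]exprMn -natrX !mulrA ler_wpM2l ?ler_nat //.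
    by rewrite !mulr_ge0 ?exprn_ge0 // ltW.
  apply: ler_sum => i _; rewrite (av_mul v_abs) avX //.
  have xa : v (x - a) <= D * v z.
    rewrite -ler_pdivrMr //; apply: le_trans D2; rewrite ler_wpM2r ?invr_ge0 ?(ltW vz) //.
    by apply: le_trans (avB v_abs _ _) _; rewrite x1.
  apply: (@le_trans _ _ (v q`_i * (D * v z) ^+ i)).
    by rewrite ler_wpM2l ?(av_ge0 v_abs) // lerXn2r ?nnegrE ?(av_ge0 v_abs) // mulr_ge0 ?ltW.
  rewrite exprMn mulrCA mulrC.
  apply: ler_pM; rewrite ?mulr_ge0 ?exprn_ge0 ?(av_ge0 v_abs) ?(ltW D0) //.
  by rewrite ler_weXn2l // -ltnS.
move=> k; rewrite [_ ^+ d in leRHS]exprMn mulrA.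
have := circle d p (M * (C * D * 2) ^+ d) 1 ltr01 _ (leq_trans sp d2) pB k.
by rewrite expr1n mulr1; apply; exists 1; apply: av1.
Qed.

End CauchyEstimate.

Section Slices.
Variables (R : realType) (K : fieldType) (v : K -> R).
Hypothesis v_abs : absolute_value v.
Hypothesis v_nontrivial : nontrivial_absolute_value v.
Hypothesis v_complete : complete_absolute_value v.
Hypothesis char0 : [pchar K] =i pred0.
Hypothesis K_closed : GRing.closed_field_axiom K.
Variables (n : nat) (F : mfps n.+1 K).
Implicit Types (k m : 'X_{1..n.+1}).

Definition slice_exp (i : 'I_n.+1) : 'X_{1..n.+1} :=
  (if i == ord_max then U_(ord0) else U_(i))%MM.

Definition slice_subst (lam : K) : mfps n.+1 K :=
  mfps_subst (fun i => if i == ord_max then lam *: mfpsX ord0 else mfpsX i) F.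

Definition slice_poly m : {poly K} :=
  \sum_(k : 'X_{1..n.+1 < (mdeg m).+1} | mnm_push slice_exp k == m)
     F k *: 'X^((k : 'X_{1..n.+1}) ord_max).

Lemma mdeg_push_slice k : mdeg (mnm_push slice_exp k) = mdeg k.
Proof.
rewrite mdeg_push mdegE; apply: eq_bigr => i _; rewrite /slice_exp.
by case: ifP; rewrite mdeg1 mul1n.
Qed.

Lemma mnm_push_slice k :
  mnm_push slice_exp k = (mnmext (mnmtrunc k) 0 + U_(ord0) *+ k ord_max)%MM.
Proof.
rewrite /mnm_push big_ord_recr /= {2}/slice_exp eqxx; congr (_ + _)%MM.
apply/mnmP => j; rewrite mnm_sumE.
have [->|[l ->]] := widen_ordP j.
  rewrite mnmext_max big1 // => i _; rewrite /slice_exp widen_neq_max mulmnE.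
  by rewrite mnm1E widen_neq_max mul0n.
rewrite mnmext_widen mnmE (bigD1 l) //= big1 ?addn0 => [|i il];
  rewrite /slice_exp widen_neq_max mulmnE mnm1E.
  by rewrite eqxx mul1n.
by rewrite (inj_eq (@widen_inj n)) (negPf il) mul0n.
Qed.

Lemma mnm_push_slice_inj k l : mnm_push slice_exp k = mnm_push slice_exp l ->
  k ord_max = l ord_max -> k = l.
Proof.
rewrite !mnm_push_slice => kl klm; move: kl; rewrite klm => /addIm.
move=> /(congr1 (@mnmtrunc n)); rewrite !mnmextK => kl.
by rewrite -(mnmtruncK k) -(mnmtruncK l) kl klm.
Qed.

Lemma slice_polyE lam m : slice_subst lam m = (slice_poly m).[lam].
Proof.
rewrite /slice_subst (@subst_monomE _ _ _ (fun i => if i == ord_max then lam else 1) slice_exp).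
- rewrite horner_sum; apply: eq_bigr => k _; rewrite hornerZ hornerXn.
  rewrite (bigD1 ord_max) //= eqxx big1 ?mulr1 // => i /negPf ->.
  by rewrite expr1n.
by move=> i; rewrite /slice_exp; case: ifP => // _; rewrite scale1r.
Qed.

Lemma size_slice_poly m : (size (slice_poly m) <= (mdeg m).+1)%N.
Proof.
apply: (leq_trans (size_sum _ _ _)); apply/bigmax_leqP => k _.
apply: (leq_trans (size_scale_leq _ _)); rewrite size_polyXn.
by apply: leq_ltn_trans (bmdeg k); apply: leq_mdeg.
Qed.

(** The degree in lambda remembers the exponent of the last variable, so the slice polynomials
    contain every coefficient of [F], and bounds on them pass to [F]. *)
Lemma coef_slice_poly k : (slice_poly (mnm_push slice_exp k))`_(k ord_max) = F k.
Proof.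
have kd : (mdeg k < (mdeg (mnm_push slice_exp k)).+1)%N by rewrite mdeg_push_slice.
rewrite coef_sum (bigD1 (BMultinom kd)) //= coefZ coefXn eqxx mulr1.
rewrite big1 ?addr0 // => l /andP[/eqP lk nlk]; rewrite coefZ coefXn.
case: eqP => [E|]; last by rewrite mulr0.
by case/eqP: nlk; apply/val_inj/mnm_push_slice_inj.
Qed.

Lemma slices_uncountable : F \notin convergent v n.+1 ->
  ~ countable (~` [set lam | slice_subst lam \in convergent v n.+1])%classic.
Proof.
move=> F_div /countable_enum[c cP].
(* Using i + 1 both as the bound and as the inverse of the radius, countably many conditions exhaust
   convergence. *)
pose ball_bound i lam := forall m,
  v (slice_poly m).[lam] * i.+1%:R^-1 ^+ mdeg m <= (i.+1%:R : R).
have [[i [a [r [r0 ir]]]]|no_ball] := pselect (exists i a r, 0 < r /\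
    forall x, v (x - a) <= r -> ball_bound i x).
  have [E E0 EP] := cauchy_ball v_abs v_nontrivial char0 K_closed a r0.
  case/negP: F_div; apply/convergentP; exists (i.+1%:R^-1 / E), (i.+1%:R : R).
  split=> [||k]; rewrite ?divr_gt0 ?invr_gt0 ?ltr0n //.
  have A0 : 0 < (i.+1%:R^-1 : R) ^+ mdeg k by rewrite exprn_gt0 // invr_gt0 ltr0n.
  have := EP _ _ (i.+1%:R / i.+1%:R^-1 ^+ mdeg k)
    (size_slice_poly (mnm_push slice_exp k)) _ (k ord_max).
  rewrite coef_slice_poly mdeg_push_slice => h.
  rewrite expr_div_n mulrA ler_pdivrMr ?exprn_gt0 // -ler_pdivlMr //.
  rewrite mulrAC; apply: h => x xa; rewrite ler_pdivlMr //.
  by have := ir x xa (mnm_push slice_exp k); rewrite mdeg_push_slice.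
(* If no bound holds on a ball, Baire's theorem yields a point outside the enumeration [c] at which
   every bound fails: failure is an open condition, by continuity of polynomials. *)
have [|x xP] := @baire R K v v_abs v_complete (fun i x => ~ ball_bound i x /\ x <> c i).
  move=> i a r r0.
  have [x [xa [m xm]]] : exists x, v (x - a) <= r / 2 /\ exists m,
      (i.+1%:R : R) < v (slice_poly m).[x] * i.+1%:R^-1 ^+ mdeg m.
    apply: contrapT => nx; apply: no_ball; exists i, a, (r / 2).
    split=> [|x xa m]; first by rewrite divr_gt0.
    by rewrite leNgt; apply/negP => xm; apply: nx; exists x; split=> //; exists m.
  have A0 : 0 < (i.+1%:R^-1 : R) ^+ mdeg m by rewrite exprn_gt0 // invr_gt0 ltr0n.
  move: xm; rewrite -ltr_pdivrMr // -subr_gt0 => xm.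
  have [d d0 dP] := horner_continuous v_abs (slice_poly m) x xm.
  have [|b [s [s0 sr bs]]] := avoid_point v_abs v_nontrivial (c i) x (r := Order.min d (r / 2)).
    by rewrite lt_min d0 divr_gt0.
  exists b, s; split=> // [|y yb].
    by move: sr; have := ge_min (r / 2) d (r / 2); rewrite lexx orbT; lra.
  have [yx yc] := bs y yb; move: yx; rewrite le_min => /andP[yd yr].
  split; first by rewrite -(subrK x y) -addrA; apply: le_trans (av_add v_abs _ _) _; lra.
  split=> // /(_ m); rewrite -ler_pdivlMr // => ym.
  have := dP y yd; have := avB v_abs (slice_poly m).[y] ((slice_poly m).[y] - (slice_poly m).[x]).
  rewrite opprB addrC subrK; lra.
(* Being different from every [c i], the point [x] has a convergent slice, which satisfies
   [ball_bound N] for [N] large. *)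
have [xW|/cP[i]] := pselect (slice_subst x \in convergent v n.+1); last first.
  by have [_] := xP i => xc cx; apply: xc.
have /convergentP[A [B [A0 B0 xB]]] := xW.
pose N := maxn (Num.bound B) (Num.bound A^-1).
have [] := xP N; case=> m; rewrite -slice_polyE.
have NB : B <= N.+1%:R.
  apply/ltW/(lt_le_trans (archi_boundP (ltW B0))).
  by rewrite ler_nat ltnW // ltnS leq_maxl.
have NA : N.+1%:R^-1 <= A.
  rewrite -[leRHS]invrK lef_pV2 ?posrE ?invr_gt0 ?ltr0n //.
  have A'0 : 0 <= A^-1 by rewrite invr_ge0 ltW.
  apply/ltW/(lt_le_trans (archi_boundP A'0)).
  by rewrite ler_nat ltnW // ltnS leq_maxr.
apply: le_trans NB; apply: le_trans (xB m); rewrite ler_wpM2l ?(av_ge0 v_abs) //.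
by rewrite lerXn2r // nnegrE ?ltW // invr_gt0 ltr0n.
Qed.

End Slices.

Lemma convergent_slices (R : realType) (K : fieldType) (v : K -> R) :
  absolute_value v -> nontrivial_absolute_value v -> complete_absolute_value v ->
  [pchar K] =i pred0 -> GRing.closed_field_axiom K ->
  temperate_slices (convergent v).
Proof.
move=> v_abs v_nt v_c char0 K_closed n F Fd W W_count.
apply: (slices_uncountable v_abs v_nt v_c char0 K_closed Fd).
(* A slice that comes from a convergent series in x' also converges as a series in all the
   variables. *)
apply: sub_countable W_count; apply: subset_card_le => lam /= nlam.
case=> h hc hE; apply: nlam; rewrite /slice_subst -hE convergent_rename //.
exact: widen_inj.
Qed.

(** * Bivariate polynomials *)

Section GaussLemma.
Variable K : fieldType.
Hypothesis K_closed : GRing.closed_field_axiom K.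
Implicit Types (c : {poly K}) (p q g Gam : {poly {poly K}}).

Lemma closed_root c : (1 < size c)%N -> exists x, root c x.
Proof.
move=> c1; have c0 : c != 0 by rewrite -size_poly_gt0 ltnW.
have lc0 : lead_coef c != 0 by rewrite lead_coef_eq0.
have [|x xE] := @K_closed (size c).-1 (fun i => - (c`_i / lead_coef c)).
  by rewrite -subn1 subn_gt0.
exists x; apply/rootP; rewrite horner_coef.
have -> : size c = (size c).-1.+1 by rewrite prednK // ltnW.
rewrite big_ord_recr /= -/(lead_coef c) xE mulr_sumr -big_split big1 //= => i _.
by rewrite mulrA mulrN mulrCA divff // mulr1 mulNr subrr.
Qed.

(** Evaluating the coefficients at [x] is reduction modulo t - x. *)
Lemma root_coef_divisor x p : map_poly (horner_eval x) p = 0 ->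
  exists q, p = ('X - x%:P) *: q.
Proof.
move=> p0; exists (map_poly (fun c => c %/ ('X - x%:P)) p).
apply/polyP => i; rewrite coefZ coef_map_id0 ?div0p // mulrC divpK //.
rewrite dvdp_XsubCl; apply/rootP.
by have := congr1 (fun q : {poly K} => q`_i) p0; rewrite coef_map coef0.
Qed.

(** Gauss's lemma by induction on the degree of [c]: if [x] is a root of [c], the product vanishes
    modulo t - x, hence so does one factor, and t - x cancels. When [c] is constant, irreducibility
    applies. *)
Lemma gauss_irreducible Gam c q g : Gam \is monic -> ring_irreducible Gam ->
  c != 0 -> c *: Gam = q * g -> size q = 1%N \/ size g = 1%N.
Proof.
move=> Gmon [G0 _ Girr]; have [n] := ubnP (size c).
elim: n c q g => // n IH c q g; rewrite ltnS => cn c0 cG.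
have [c1|c1] := leqP (size c) 1.
  have [u u0 cE] : exists2 u, u != 0 & c = u%:P.
    by exists c`_0; [rewrite -polyC_eq0 -size1_polyC | apply: size1_polyC].
  have : Gam = (u^-1%:P *: q) * g.
    by rewrite -scalerAl -cG cE scalerA -polyCM mulVf // scale1r.
  have uP0 : u^-1%:P != 0 by rewrite polyC_eq0 invr_eq0.
  by case/Girr; rewrite poly_unitE => /andP[/eqP + _]; rewrite ?size_scale //; [left|right].
have [x cx] := closed_root c1.
have /factor_theorem[c' cE] := cx.
have X0 : 'X - x%:P != 0 :> {poly K} by rewrite polyXsubC_eq0.
have sI (p1 p2 : {poly {poly K}}) :
    ('X - x%:P) *: p1 = ('X - x%:P) *: p2 -> p1 = p2.
  by rewrite -!mul_polyC; apply: mulfI; rewrite polyC_eq0.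
have c'0 : c' != 0 by apply: contraNneq c0 => c'0; rewrite cE c'0 mul0r.
have c'n : (size c' < n)%N.
  by apply: leq_trans cn; rewrite cE size_mul // size_XsubC addn2.
have /eqP : map_poly (horner_eval x) q * map_poly (horner_eval x) g = 0.
  rewrite -rmorphM -cG; apply/polyP => i.
  by rewrite coef_map coefZ /= /horner_eval hornerM (rootP cx) mul0r coef0.
rewrite mulf_eq0 => /orP[]/eqP/root_coef_divisor[r rE].
  have [||] := IH c' r g c'n c'0; rewrite ?rE ?size_scale //; [|by left|by right].
  by apply: sI; rewrite scalerA mulrC -cE cG rE scalerAl.
have [||] := IH c' q r c'n c'0; rewrite ?rE ?size_scale //; [|by left|by right].
by apply: sI; rewrite scalerA mulrC -cE cG rE scalerAr.
Qed.

(** By Gauss's lemma the gcd of [p] and [Gam] has degree 0 in z, so their Bezout relation gives a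
    nonzero element of K[t]. *)
Lemma irreducible_bezout Gam p : Gam \is monic -> ring_irreducible Gam ->
  p != 0 -> (size p < size Gam)%N ->
  exists u w d, d != 0 /\ u * p + w * Gam = d%:P.
Proof.
move=> Gmon Girr p0 pG; have [u uE] := Bezoutp p Gam.
pose g := gcdp p Gam; have gp : g %| p := dvdp_gcdl p Gam.
have g1 : size g = 1%N.
  have /Pdiv.Idomain.dvdpP[[c q] /= c0 cG] : g %| Gam := dvdp_gcdr p Gam.
  have [q1|//] := gauss_irreducible Gmon Girr c0 cG.
  have g0 : g != 0.
    apply: contraNneq c0 => g0; move/eqP: cG; rewrite g0 mulr0 scale_poly_eq0.
    by rewrite (negPf (monic_neq0 Gmon)) orbF.
  have q0 : q != 0 by rewrite -size_poly_eq0 q1.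
  have := dvdp_leq p0 gp; rewrite leqNgt -[size g]/(1 + size g).-1 -q1 -size_mul //.
  by rewrite -cG size_scale // pG.
have /eqP s1 := eqp_size uE; rewrite -/g g1 in s1.
exists u.1, u.2, (u.1 * p + u.2 * Gam)`_0; split.
  by rewrite -polyC_eq0 -size1_polyC ?(eqP s1) // -size_poly_eq0 (eqP s1).
by apply: size1_polyC; rewrite (eqP s1).
Qed.

End GaussLemma.

(** * Weighted degrees and Euclidean division *)

Section WeightedDegree.
Variables (K : fieldType) (al : nat).
Implicit Types (p q : {poly {poly K}}).

(** The variable t has weight 1 and z has weight [al]. *)
Definition wdeg_le n p := forall i j, p`_i`_j != 0 -> (j + al * i <= n)%N.

Lemma wdeg_leB n p q : wdeg_le n p -> wdeg_le n q -> wdeg_le n (p - q).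
Proof.
move=> pn qn i j; rewrite !coefB.
have [->|/pn //] := eqVneq p`_i`_j 0.
by rewrite sub0r oppr_eq0 => /qn.
Qed.

Lemma wdeg_leM m n p q : wdeg_le m p -> wdeg_le n q -> wdeg_le (m + n) (p * q).
Proof.
move=> pm qn i j; apply: contraR; rewrite -ltnNge => mn.
rewrite coefM coef_sum big1 // => a _; rewrite coefM big1 // => b _.
have [->|/pm pab] := eqVneq p`_a`_b 0; first by rewrite mul0r.
have [->|/qn qab] := eqVneq q`_(i - a)`_(j - b) 0; first by rewrite mulr0.
have ai : (a <= i)%N by rewrite -ltnS.
have bj : (b <= j)%N by rewrite -ltnS.
suff : (j + al * i <= m + n)%N by rewrite leqNgt mn.
apply: leq_trans (leq_add pab qab).
by rewrite addnACA subnKC // -mulnDr subnKC.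
Qed.

Lemma wdeg_leX m p k : wdeg_le m p -> wdeg_le (k * m) (p ^+ k).
Proof.
move=> pm; elim: k => [|k IH]; last by rewrite exprS mulSn; apply: wdeg_leM.
move=> i j; rewrite expr0 coef1; case: i => [|i]; last by rewrite coef0 eqxx.
by rewrite coef1; case: j => [|j]; rewrite ?muln0 // eqxx.
Qed.

Lemma wdeg_le_deriv n p : wdeg_le n p -> wdeg_le n p^`().
Proof.
move=> pn i j; rewrite coef_deriv coefMn => pij.
have /pn : p`_i.+1`_j != 0 by apply: contraNneq pij => ->; rewrite mul0rn.
by apply: leq_trans; rewrite leq_add2l leq_mul2l leqnSn orbT.
Qed.

(** The weight hypothesis says that no term of [Gam] is heavier than its leading term z^e, so
    cancelling the leading term of [p] does not raise the weight. *)
Lemma wdeg_le_mod e (Gam : {poly {poly K}}) : Gam \is monic -> size Gam = e.+1 ->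
  wdeg_le (al * e) Gam ->
  forall n p, wdeg_le n p -> exists q r,
    [/\ p = q * Gam + r, wdeg_le n r & (size r <= e)%N].
Proof.
move=> Gmon Ge Gw n p; have [s] := ubnP (size p).
elim: s p => // s IH p; rewrite ltnS => ps pn.
have [pe|pe] := leqP (size p) e; first by exists 0, p; rewrite mul0r add0r.
pose k := ((size p).-1 - e)%N.
have p0 : (0 < size p)%N by apply: leq_trans pe.
pose t : {poly {poly K}} := (lead_coef p)%:P * 'X^k.
have tn : wdeg_le n (t * Gam).
  move=> i j; rewrite /t -mulrA coefCM coefXnM; case: ltnP => ki.
    by rewrite mulr0 coef0 eqxx.
  apply: contraR; rewrite -ltnNge => nij; rewrite coefM big1 // => b _.
  have [->|/pn pb] := eqVneq (lead_coef p)`_b 0; first by rewrite mul0r.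
  have [->|/Gw Gb] := eqVneq Gam`_(i - k)`_(j - b) 0; first by rewrite mulr0.
  have bj : (b <= j)%N by rewrite -ltnS.
  suff : (j + al * i <= n)%N by rewrite leqNgt nij.
  apply: leq_trans pb.
  have -> : (size p).-1 = (e + k)%N by rewrite /k subnKC // -ltnS prednK.
  rewrite mulnDr addnA; apply: (@leq_trans (b + (j - b + al * (i - k)) + al * k)).
    by rewrite addnA subnKC // -addnA -mulnDr subnK.
  by rewrite leq_add2r leq_add2l.
have pts : (size (p - t * Gam)%R < s)%N.
  apply: leq_trans ps; rewrite ltnNge; apply/negP => sp.
  have st : size (t * Gam) = size p.
    have lp0 : lead_coef p != 0 by rewrite lead_coef_eq0 -size_poly_gt0.
    have t_size : size t = k.+1 by rewrite /t size_Cmul // size_polyXn.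
    by rewrite size_Mmonic ?Ge // -?size_poly_gt0 t_size // /k; lia.
  have E : (p - t * Gam)`_(size p).-1 = 0.
    rewrite coefB -{2}st -/(lead_coef (t * Gam)) lead_coef_Mmonic //.
    by rewrite lead_coefM lead_coefC lead_coefXn mulr1 subrr.
  have ss : size (p - t * Gam) = size p.
    apply/eqP; rewrite eqn_leq sp andbT; apply: leq_trans (size_polyD _ _) _.
    by rewrite size_polyN st maxnn.
  have : lead_coef (p - t * Gam) = 0 by rewrite /lead_coef ss.
  by move/eqP; rewrite lead_coef_eq0 -size_poly_eq0 ss -leqn0 leqNgt p0.
have [q [r [pE rn re]]] := IH _ pts (wdeg_leB pn tn).
exists (q + t), r; split=> //.
by rewrite mulrDl addrAC -pE subrK.
Qed.

End WeightedDegree.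

Lemma nontrivial_kernel (K : fieldType) (I J : finType) (M : I -> J -> K) :
  (#|J| < #|I|)%N ->
  exists c : I -> K, (exists i, c i != 0) /\ forall j, \sum_i c i * M i j = 0.
Proof.
move=> JI; pose A := \matrix_(i < #|I|, j < #|J|) M (enum_val i) (enum_val j).
have : kermx A != 0.
  rewrite kermx_eq0 /row_free neq_ltn (leq_ltn_trans _ JI) //.
  exact: rank_leq_col.
case/rowV0Pn => w; rewrite sub_kermx => /eqP wA w0.
exists (fun i => w 0 (enum_rank i)); split.
  have /existsP[i wi] : [exists i, w 0 i != 0].
    apply: contraNT w0; rewrite negb_exists => /forallP h.
    by apply/eqP/rowP => i; rewrite mxE; apply/eqP; rewrite -[_ == _]negbK.
  by exists (enum_val i); rewrite enum_valK.
move=> j; have := congr1 (fun B : 'rV_#|J| => B 0 (enum_rank j)) wA.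
rewrite !mxE => E0; rewrite -[RHS]E0 [RHS](reindex_onto enum_rank enum_val) /=; last first.
  by move=> i _; apply: enum_valK.
under [RHS]eq_bigl do rewrite enum_rankK eqxx.
by apply: eq_bigr => i _; rewrite mxE !enum_rankK.
Qed.

(** * Lagrange interpolation over a commutative ring *)

Section Interpolation.
Variable A : comNzRingType.
Implicit Types (h : {poly A}) (l : seq A).
Local Notation Pi l := (\prod_(b <- l) ('X - b%:P)).

Lemma horner_sub_factor h b : exists q, h = (h.[b])%:P + q * ('X - b%:P).
Proof.
have /factor_theorem[q qE] : root (h - (h.[b])%:P) b.
  by apply/rootP; rewrite hornerD hornerN hornerC subrr.
by exists q; rewrite -qE addrC subrK.
Qed.

(** The induction removes one root at a time by the product rule for the derivative, so no
    difference of roots is ever inverted. *)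
Lemma interpolation_ideal h t l : (forall b, b \in l -> exists c, h.[b] = t * c) ->
  exists s q : {poly A}, (size s <= size l)%N /\ h * (Pi l)^`() = t *: s + q * Pi l.
Proof.
elim: l => [|b l IH] lt.
  by exists 0, 0; rewrite size_poly0 big_nil derivC !mulr0 scaler0 mul0r addr0.
have [|s [q [sl hE]]] := IH; first by move=> c cl; apply: lt; rewrite in_cons cl orbT.
have [c hb] := lt b (mem_head _ _); have [r rE] := horner_sub_factor h b.
exists (c *: Pi l + ('X - b%:P) * s), (r + q); split.
  apply: leq_trans (size_polyD _ _) _; rewrite geq_max; apply/andP; split.
    by apply: leq_trans (size_scale_leq _ _) _; rewrite size_prod_XsubC.
  by apply: leq_trans (size_polyMleq _ _) _; rewrite size_XsubC.
rewrite big_cons derivM derivXsubC mul1r mulrDr mulrCA hE {1}rE hb.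
rewrite polyCM -!mul_polyC; ring.
Qed.

(* Lagrange interpolation of h * Pi' at the roots, modulo the ideal (t). *)
Lemma interpolation_mod h t b l :
  (forall c, c \in l -> exists d, h.[c] = t * d) ->
  exists s q : {poly A}, (size s <= (size l).+1)%N /\
    h * (Pi (b :: l))^`() = h.[b] *: Pi l + t *: s + q * Pi (b :: l).
Proof.
move=> /interpolation_ideal[s [q [sl hE]]].
have [r rE] := horner_sub_factor h b.
exists (('X - b%:P) * s), (r + q); split.
  by apply: leq_trans (size_polyMleq _ _) _; rewrite size_XsubC.
rewrite big_cons derivM derivXsubC mul1r mulrDr mulrCA hE {1}rE.
rewrite -!mul_polyC; ring.
Qed.

End Interpolation.

(** * Values of polynomials at conjugate series *)

Section OneVariable.
Variable K : fieldType.
Implicit Types (f g : mfps 1 K) (p : {poly K}) (m : 'X_{1..1}).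

Lemma mnm_one m : m = (U_(ord0) *+ m ord0)%MM.
Proof.
by apply/mnmP => i; rewrite mulmnE mnm1E !ord1 eqxx mul1n.
Qed.

Definition mono1 j : 'X_{1..1} := (U_(ord0) *+ j)%MM.

Lemma mono1E j : mono1 j ord0 = j.
Proof. by rewrite mulmnE mnm1E eqxx mul1n. Qed.

Lemma mdeg_mono1 j : mdeg (mono1 j) = j.
Proof. by rewrite mdegMn mdeg1 mul1n. Qed.

Definition tser : mfps 1 K := mfpsX ord0.
Local Notation T := tser.

Lemma mulTX f d j : (f * T ^+ d) (mono1 (j + d)) = f (mono1 j).
Proof.
rewrite /tser mfpsX_Xm -mfpsXm_muln mfpsMXm ifT.
  by congr (mfps_coeff f); apply/mnmP => i; rewrite mnmBE !mulmnE !ord1 mnm1E !mul1n addnK.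
by apply/mnm_lepP => i; rewrite !mulmnE !ord1 mnm1E !mul1n leq_addl.
Qed.

Lemma mulTX_lt f d j : (j < d)%N -> (f * T ^+ d) (mono1 j) = 0.
Proof.
move=> jd; rewrite /tser mfpsX_Xm -mfpsXm_muln mfpsMXm ifF //.
by apply/mnm_lepP => /(_ ord0); rewrite !mulmnE mnm1E !mul1n leqNgt jd.
Qed.

Lemma dvd_TX f d : (forall j, (j < d)%N -> f (mono1 j) = 0) -> f = tau d f * T ^+ d.
Proof.
move=> f0; rewrite {1}(tau_low_dec d f).
have -> : low d f = 0.
  apply: mfpsP => m /=; case: ifP => // md; rewrite (mnm_one m) f0 //.
  by move: md; congr (m _ < _)%N; apply: val_inj.
rewrite addr0 /tser mfpsX_Xm -mfpsXm_muln; congr (_ * mfpsXm _ (U_(_) *+ _)%MM).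
Qed.

Lemma mulTX_inj d : injective (fun f => f * T ^+ d).
Proof.
move=> f g fg; apply: mfpsP => m; rewrite (mnm_one m) -/(mono1 _).
by rewrite -(mulTX f d) -(mulTX g d) fg.
Qed.

Local Notation phi := (horner_alg (mfpsX ord0 : mfps 1 K)).

Lemma phi_sum p : phi p = \sum_(i < size p) p`_i *: T ^+ i.
Proof.
rewrite -{1}[p]coefK poly_def raddf_sum /=; apply: eq_bigr => i _.
rewrite linearZ /= mulr_algl rmorphXn; congr (_ *: _ ^+ _).
exact: horner_algX.
Qed.

Lemma phiE p m : phi p m = p`_(m ord0).
Proof.
rewrite (mnm_one m) -/(mono1 _) mono1E; move: (m ord0) => j.
rewrite phi_sum mfps_sumE.
transitivity (\sum_(i < size p) (p`_i * (j == i)%:R)).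
  apply: eq_bigr => i _; rewrite mfpsZE.
  congr (_ * _); rewrite -[_ ^+ _]mul1r; case: (ltngtP j i) => [ji|ij|->].
  - by rewrite -/tser mulTX_lt.
  - rewrite -/tser -(subnK (ltnW ij)) mulTX mfps1E -mdeg_eq0 mdeg_mono1.
    by rewrite subn_eq0 leqNgt ij.
  by rewrite -[mono1 _]/(mono1 (0 + i)) -/tser mulTX mfps1E /mono1 mulm0n eqxx.
have [jp|pj] := ltnP j (size p).
  rewrite (bigD1 (Ordinal jp)) //= eqxx mulr1 big1 ?addr0 // => i ij.
  by rewrite eq_sym -val_eqE /= in ij; rewrite (negPf ij) mulr0.
rewrite nth_default // big1 // => i _.
by rewrite gtn_eqF ?mulr0 // (leq_trans (ltn_ord i)).
Qed.

Lemma phi_eq0 p : phi p = 0 -> p = 0.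
Proof.
move=> p0; apply/polyP => j; rewrite coef0 -[j]mono1E -phiE p0.
by [].
Qed.

End OneVariable.

Section ConvergentOneVariable.
Variables (R : realType) (K : fieldType) (v : K -> R).
Hypothesis v_abs : absolute_value v.
Local Notation phi := (horner_alg (mfpsX ord0 : mfps 1 K)).
Local Notation conv := (convergent v 1).
Local Notation T := (@tser K).
Implicit Types (f g : mfps 1 K).

Lemma convergentD n (f g : mfps n K) :
  f \in convergent v n -> g \in convergent v n -> f + g \in convergent v n.
Proof.
move=> fc gc; rewrite -[f]scale1r.
by case: (convergent_subalg v_abs n) => _ cD _; apply: cD.
Qed.

Lemma convergent_sum n (I : Type) (r : seq I) (P : pred I) (F : I -> mfps n K) :
  (forall i, P i -> F i \in convergent v n) ->
  \sum_(i <- r | P i) F i \in convergent v n.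
Proof.
move=> Fc; elim/big_ind: _ => //; first exact: convergent0.
by move=> x y; apply: convergentD.
Qed.

Lemma convergentX n (f : mfps n K) i :
  f \in convergent v n -> f ^+ i \in convergent v n.
Proof.
move=> fc; elim: i => [|i IH]; first exact: convergent1.
by rewrite exprS; apply: convergentM.
Qed.

Lemma convergent_phi (p : {poly K}) : phi p \in conv.
Proof.
rewrite phi_sum; apply: convergent_sum => i _.
apply/convergentZ/convergentX => //.
exact: convergent_mpoly.
Qed.

Definition ev (f : {poly {poly K}}) g : mfps 1 K := (map_poly phi f).[g].

Lemma convergent_ev (f : {poly {poly K}}) g : g \in conv -> ev f g \in conv.
Proof.
move=> gc; rewrite /ev horner_coef; apply: convergent_sum => i _.
rewrite coef_map; apply: convergentM => //; first exact: convergent_phi.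
exact: convergentX.
Qed.

(** Division by a nonzero convergent series is thereby possible at the cost of a power of [T] and
    the convergent factor [w]. *)
Lemma convergent_order f : f \in conv -> f != 0 -> exists s u w,
  [/\ f = u * T ^+ s, u * w = 1 & w \in conv].
Proof.
move=> fc f0; have [s fs smin] : exists2 s, f (mono1 s) != 0 &
    forall j, (j < s)%N -> f (mono1 j) = 0.
  have ex_j : exists j, f (mono1 j) != 0.
    apply: contrapT => nj; case/eqP: f0; apply: mfpsP => m.
    rewrite (mnm_one m); apply: contrapT => fm; apply: nj; exists (m ord0).
    exact/eqP.
  case: (ex_minnP ex_j) => s fs smin; exists s => // j js.
  by apply/eqP; apply: contraTT js => /smin; rewrite leqNgt.
have tc : tau s f \in conv by apply: tau_convergent.
have [|w wc tw] := convergent_unit v_abs tc.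
  by rewrite tauE add0m (_ : ord_max = ord0) //; apply: val_inj.
by exists s, (tau s f), w; split=> //; apply: dvd_TX.
Qed.

Lemma convergent_integral f g : f \in conv -> f * g = 0 -> f = 0 \/ g = 0.
Proof.
move=> fc fg; have [->|f0] := eqVneq f 0; [by left | right].
have [s [u [w [fE uw _]]]] := convergent_order fc f0.
apply: (@mulTX_inj _ s); rewrite mul0r -[g]mul1r -uw.
by have -> : u * w * g * T ^+ s = w * (f * g); [rewrite fE; ring | rewrite fg mulr0].
Qed.

Lemma root_split (rs : seq (mfps 1 K)) g : {subset rs <= conv} -> g \in conv ->
  root (\prod_(a <- rs) ('X - a%:P)) g -> g \in rs.
Proof.
move=> rsc gc; rewrite rootE horner_prod; elim: rs rsc => [|a rs IH] rsc.
  by rewrite big_nil oner_eq0.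
rewrite big_cons hornerXsubC => /eqP/convergent_integral[|/eqP|/eqP grs].
- by rewrite convergentB //; apply: rsc; rewrite mem_head.
- by rewrite subr_eq0 in_cons => ->.
by rewrite in_cons IH ?orbT // => b brs; apply: rsc; rewrite in_cons brs orbT.
Qed.

Lemma convergent_prod_XsubC (l : seq (mfps 1 K)) i : {subset l <= conv} ->
  (\prod_(a <- l) ('X - a%:P))`_i \in conv.
Proof.
elim: l i => [|a l IH] i lc.
  rewrite big_nil coef1; case: eqP => _; [exact: convergent1 | exact: convergent0].
have lc' : {subset l <= conv} by move=> b bl; apply: lc; rewrite in_cons bl orbT.
rewrite big_cons mulrBl coefB coefXM coefCM; apply: convergentB => //.
  by case: eqP => _; [exact: convergent0 | exact: IH].
by apply: convergentM => //; [apply: lc; rewrite mem_head | apply: IH].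
Qed.

End ConvergentOneVariable.

(** * Series in two variables and their slices *)

Section TwoVariables.
Variable K : fieldType.
Local Notation phi := (horner_alg (mfpsX ord0 : mfps 1 K)).
Local Notation iota2 := (@mfps_rename 1 2 K (fun=> ord_max)).

Definition mono2 k l : 'X_{1..2} := (U_(ord0) *+ k + U_(ord_max) *+ l)%MM.

Lemma mono2_0 k l : mono2 k l ord0 = k.
Proof. by rewrite mnmDE !mulmnE !mnm1E /= mul1n addn0. Qed.

Lemma mono2_max k l : mono2 k l ord_max = l.
Proof. by rewrite mnmDE !mulmnE !mnm1E /= mul1n. Qed.

Lemma ord2P (i : 'I_2) : i = ord0 \/ i = ord_max.
Proof. by case: i => [[|[|]]] //= h; [left|right]; apply: val_inj. Qed.

Lemma mono2K (m : 'X_{1..2}) : m = mono2 (m ord0) (m ord_max).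
Proof.
by apply/mnmP => i; have [->|->] := ord2P i; rewrite (mono2_0, mono2_max).
Qed.

Lemma mono2_le k l k' l' : (mono2 k l <= mono2 k' l')%MM = (k <= k')%N && (l <= l')%N.
Proof.
apply/mnm_lepP/andP => [h|[kk ll] i].
  by have := h ord0; have := h ord_max; rewrite !mono2_0 !mono2_max.
by have [->|->] := ord2P i; rewrite ?mono2_0 ?mono2_max.
Qed.

Lemma mono2B k l k' l' : (mono2 k l - mono2 k' l')%MM = mono2 (k - k') (l - l').
Proof.
apply/mnmP => i; rewrite mnmBE; have [->|->] := ord2P i.
  by rewrite !mono2_0.
by rewrite !mono2_max.
Qed.

Lemma mdeg_mono2 k l : mdeg (mono2 k l) = (k + l)%N.
Proof. by rewrite mdegD !mdegMn !mdeg1 !mul1n. Qed.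

(** The coefficient of x_1^k, as a series in x_2. *)
Definition slice k (f : mfps 2 K) : mfps 1 K := MFPS (fun m => f (mono2 k (m ord0))).

Lemma slice_is_additive k : {morph slice k : f g / f + g}.
Proof. by move=> f g; apply: mfpsP. Qed.

Lemma const_ord_inj : injective (fun _ : 'I_1 => ord_max : 'I_2).
Proof. by move=> i j _; rewrite !ord1. Qed.

Lemma iota2E (h : mfps 1 K) k l :
  iota2 h (mono2 k l) = if k == 0%N then h (mono1 l) else 0.
Proof.
have push j : mnm_rename (fun _ : 'I_1 => ord_max : 'I_2) j = mono2 0 (j ord0).
  by apply/mnmP => i; rewrite mnm_pushE big_ord1 mnmDE !mulmnE muln0 add0n.
case: eqP => [->|/eqP k0].
  by rewrite -(mfps_renameE const_ord_inj h) push mono1E.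
apply: mfps_rename0 => j; rewrite push; apply: contra k0 => /eqP.
by move=> /(congr1 (fun m : 'X_{1..2} => m ord0)); rewrite !mono2_0 => <-.
Qed.

(** A series in x_2 alone acts separately on each coefficient of x_1^k; both products are expanded
    along the exponents of x_2. *)
Lemma slice_mul_iota2 k f h : slice k (f * iota2 h) = slice k f * h.
Proof.
apply: mfpsP => m; rewrite (mnm_one m) -/(mono1 _); move: (m ord0) => l.
rewrite -[LHS]/((f * iota2 h) (mono2 k (mono1 l ord0))) mono1E.
rewrite (@mfpsM_seq _ _ f _ _ [seq mono2 0 j | j <- iota 0 l.+1]).
- rewrite (@mfpsM_seq _ _ (slice k f) _ _ [seq mono1 j | j <- iota 0 l.+1]).
  + rewrite !big_map; apply: eq_big_seq => j.
    rewrite mem_iota => /andP[_ jl].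
    rewrite mono2B subn0 iota2E eqxx.
    by rewrite -[slice _ _ _]/(f (mono2 k ((mono1 l - mono1 j)%MM ord0))) mnmBE !mono1E.
  + by rewrite map_inj_uniq ?iota_uniq // => i j /(congr1 (@mdeg 1)); rewrite !mdeg_mono1.
  + move=> j /mapP[i]; rewrite mem_iota add0n leq0n ltnS /= => il ->.
    by apply/mnm_lepP => o; rewrite !ord1 !mono1E.
  move=> j /mnm_lepP/(_ ord0); rewrite mono1E => jl _; apply/mapP.
  by exists (j ord0); [rewrite mem_iota add0n leq0n ltnS | apply: mnm_one].
- rewrite map_inj_uniq ?iota_uniq // => i j /(congr1 (@mdeg 2)).
  by rewrite !mdeg_mono2.
- move=> j /mapP[i]; rewrite mem_iota add0n leq0n ltnS /= => il ->.
  by rewrite mono2_le.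
move=> j; rewrite {1 2}(mono2K j) mono2_le => /andP[_ jl]; rewrite iota2E.
case: (j ord0 =P 0%N) => [j0 _|_]; last by rewrite eqxx.
apply/mapP; exists (j ord_max); first by rewrite mem_iota add0n leq0n ltnS.
by rewrite {1}(mono2K j) j0.
Qed.

(** This reduces condition (c) to estimates on the series p_k(t, g(t)) in one variable. *)
Lemma slice_eval (p : nat -> {poly {poly K}}) (P : {poly mfps 2 K}) g k :
  is_graded_sum p P -> slice k (eval_at_series P g) = ev (p k) g.
Proof.
move=> Pp; rewrite /eval_at_series /ev horner_coef.
have sz : (size (p k) <= size P)%N.
  apply/leq_sizeP => i Pi; apply/polyP => j.
  by have := Pp i (mono2 k j); rewrite mono2_0 mono2_max nth_default // => <-; rewrite coef0.
rewrite (horner_coef_wide _ (leq_trans (size_poly _ _) sz)).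
have s0 : slice k 0 = 0 by apply: mfpsP.
rewrite (big_morph _ (slice_is_additive k) s0); apply: eq_bigr => i _.
have -> (f : mfps 2 K) j : slice k (f * iota2 g ^+ j) = slice k f * g ^+ j.
  elim: j => [|j IH]; first by rewrite !expr0 !mulr1.
  by rewrite !exprSr !mulrA slice_mul_iota2 IH.
congr (_ * _); rewrite coef_map; apply: mfpsP => m; rewrite phiE /=.
by rewrite Pp mono2_0 mono2_max.
Qed.

End TwoVariables.

(** * The auxiliary polynomial and the truncation identity *)

Section AuxiliaryPolynomial.
Variable K : fieldType.
Local Notation phi := (horner_alg (mfpsX ord0 : mfps 1 K)).
Local Notation T := (@tser K).
Implicit Types (f : {poly {poly K}}) (g : mfps 1 K).

Lemma evM f1 f2 g : ev (f1 * f2) g = ev f1 g * ev f2 g.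
Proof. by rewrite /ev rmorphM hornerM. Qed.

Lemma evX f g i : ev (f ^+ i) g = ev f g ^+ i.
Proof. by rewrite /ev rmorphXn horner_exp. Qed.

Lemma evD f1 f2 g : ev (f1 + f2) g = ev f1 g + ev f2 g.
Proof. by rewrite /ev rmorphD hornerD. Qed.

Lemma ev_wide f g e : (size f <= e)%N -> ev f g = \sum_(i < e) phi f`_i * g ^+ i.
Proof.
move=> fe; rewrite /ev (horner_coef_wide _ (leq_trans (size_poly _ _) fe)).
by apply: eq_bigr => i _; rewrite coef_map.
Qed.

(* With M = m + 1, there are e (M - al (e - 1)) free coefficients against
   (e - 1) M conditions. *)
Lemma auxiliary_poly (al : nat) (l : seq (mfps 1 K)) (e := (size l).+1) :
  exists (m : nat) (a : {poly {poly K}}), [/\ a != 0, (size a <= e)%N, wdeg_le al m a &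
    forall b, b \in l -> exists c, ev a b = T ^+ m.+1 * c].
Proof.
(* The choice of [m] makes [m.+1] exceed [al * e * (e - 1)], so that there are more unknowns than
   conditions; [L] is such that the monomials with i < e and j < L have weight at most [m]. *)
pose m := (al * e * e)%N; pose L := (m.+1 - al * (size l))%N.
pose M (ij : 'I_e * 'I_L) (bj : 'I_(size l) * 'I_m.+1) :=
  (T ^+ ij.2 * (nth 0 l bj.1) ^+ ij.1) (mono1 bj.2).
have [|c [[[i0 j0] c0] cM]] := @nontrivial_kernel K _ _ M.
  rewrite !card_prod !card_ord /L /m /e.
  have : (al * size l <= al * (size l).+1 * (size l).+1)%N.
    by rewrite -mulnA leq_mul2l mulSn; apply/orP; right; lia.
  by nia.
pose a : {poly {poly K}} := \poly_(i < e) \poly_(j < L)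
  (if insub i is Some i' then if insub j is Some j' then c (i', j') else 0 else 0).
have aE (i : 'I_e) (j : 'I_L) : a`_i`_j = c (i, j).
  by rewrite /a coef_poly ltn_ord coef_poly ltn_ord !valK.
exists m, a; split.
- by apply: contraNneq c0 => a0; rewrite -aE a0 !coef0.
- exact: size_poly.
- move=> i j; rewrite /a coef_poly; case: ifP => [ie|]; last by rewrite coef0 eqxx.
  rewrite coef_poly; case: ifP => [jL _|]; last by rewrite eqxx.
  have : (al * i <= al * size l)%N by rewrite leq_mul2l -ltnS ie orbT.
  by move: jL; rewrite /L; lia.
move=> b bl; suff /dvd_TX E : forall j, (j < m.+1)%N -> ev a b (mono1 j) = 0.
  by exists (tau m.+1 (ev a b)); rewrite mulrC.
move=> j jm; have bs : (index b l < size l)%N by rewrite index_mem.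
have := cM (Ordinal bs, Ordinal jm).
rewrite (@ev_wide a b e (size_poly _ _)) mfps_sumE => E0; rewrite -[RHS]E0 {E0}.
transitivity (\sum_i \sum_j0 c (i, j0) * M (i, j0) (Ordinal bs, Ordinal jm)); last first.
  by rewrite pair_bigA; apply: eq_bigr => -[].
apply: eq_bigr => i _; rewrite phi_sum.
have -> : \sum_(j1 < size (a`_i)%R) a`_i`_j1 *: T ^+ j1 = \sum_(j1 < L) c (i, j1) *: T ^+ j1.
  have sL : (size (a`_i)%R <= L)%N by rewrite /a coef_poly ltn_ord size_poly.
  rewrite (big_ord_widen L (fun j1 => a`_i`_j1 *: T ^+ j1) sL) big_mkcond.
  apply: eq_bigr => j1 _; rewrite aE; case: ltnP => // h.
  by rewrite -aE nth_default // scale0r.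
rewrite mulr_suml mfps_sumE; apply: eq_bigr => j1 _.
by rewrite -scalerAl mfpsZE /M /= nth_index.
Qed.

(* Writing f a^N Gam' = q Gam + H, Lagrange interpolation gives
   H(Z) = \sum_b f(b) a(b)^N \prod_(c <> b) (Z - c), in which all terms but the one
   of g vanish modulo T^((m+1) N); the degree of H in t is too small to see the
   others, so H is a truncation of the term of g. *)
Lemma conjugate_identity (al m D N : nat) (Gam a f : {poly {poly K}}) g
    (l : seq (mfps 1 K)) (e := (size l).+1) :
  Gam \is monic -> wdeg_le al (al * e) Gam ->
  map_poly phi Gam = \prod_(b <- g :: l) ('X - b%:P) ->
  wdeg_le al m a -> (forall b, b \in l -> exists c, ev a b = T ^+ m.+1 * c) ->
  wdeg_le al D f -> N = (D + al * e).+1 ->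
  exists H : {poly {poly K}}, [/\ (size H <= e)%N,
    forall b, root (map_poly phi Gam) b -> ev f b * ev a b ^+ N * ev Gam^`() b = ev H b &
    forall i x, phi H`_i x = 0 \/
      phi H`_i x = (ev f g * ev a g ^+ N * (\prod_(b <- l) ('X - b%:P))`_i) x].
Proof.
move=> Gmon Gw GE aw al_dvd fw NE.
have sG : size Gam = e.+1.
  rewrite -[RHS](size_prod_XsubC (g :: l) id) -GE size_map_poly_id0 //.
  by rewrite (monicP Gmon) rmorph1 oner_neq0.
(* [N] is chosen so that the weight D + N m + al e of the product stays just below (m + 1) N. *)
have hw : wdeg_le al ((m.+1 * N).-1) (f * a ^+ N * Gam^`()).
  have -> : (m.+1 * N).-1 = (D + N * m + al * e)%N by rewrite NE; lia.
  exact: wdeg_leM (wdeg_leM fw (wdeg_leX aw)) (wdeg_le_deriv Gw).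
have [q [H [hE Hw He]]] := wdeg_le_mod Gmon sG Gw hw.
exists H; split=> //.
  move=> b /rootP Gb; rewrite -evX -!evM hE evD evM.
  by rewrite [ev Gam b]Gb mulr0 add0r.
have [|s [r [sl hE2]]] := @interpolation_mod _ (map_poly phi (f * a ^+ N)) (T ^+ (m.+1 * N)) g l.
  move=> b /al_dvd[c aE]; exists (ev f b * c ^+ N).
  by rewrite -[LHS]/(ev _ b) evM evX aE exprMn -exprM mulrCA.
set G1 := \prod_(b <- l) _ in hE2 *.
pose h := ev f g * ev a g ^+ N.
have E : map_poly phi H - h *: G1 - T ^+ (m.+1 * N) *: s =
    (r - map_poly phi q) * map_poly phi Gam.
  have : map_poly phi (q * Gam + H) = h *: G1 + T ^+ (m.+1 * N) *: s + r * map_poly phi Gam.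
    transitivity (map_poly phi (f * a ^+ N) * (map_poly phi Gam)^`()).
      by rewrite -hE rmorphM deriv_map.
    rewrite GE hE2; congr (_ *: _ + _ + _).
    by rewrite -[LHS]/(ev _ g) evM evX.
  rewrite rmorphD rmorphM mulrBl => /(canRL (addKr _)) ->; ring.
have Gmon' : map_poly phi Gam \is monic by rewrite GE monic_prod_XsubC.
(* The left-hand side of [E] has size at most [e], whereas a nonzero multiple of the monic [Gam] has
   size greater than [e]. *)
have H0 : map_poly phi H - h *: G1 - T ^+ (m.+1 * N) *: s = 0.
  have [r0|r0] := eqVneq (r - map_poly phi q) 0; first by rewrite E r0 mul0r.
  have : (size (map_poly phi H - h *: G1 - T ^+ (m.+1 * N) *: s)%R <= e)%N.
    apply: leq_trans (size_polyD _ _) _; rewrite geq_max size_polyN; apply/andP; split.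
      apply: leq_trans (size_polyD _ _) _; rewrite geq_max size_polyN; apply/andP; split.
        exact: leq_trans (size_poly _ _) He.
      by apply: leq_trans (size_scale_leq _ _) _; rewrite size_prod_XsubC.
    exact: leq_trans (size_scale_leq _ _) sl.
  rewrite E size_Mmonic // GE size_prod_XsubC /= addnS /= -/e => sE.
  by move: sE; rewrite -{2}[e]add0n leq_add2r leqNgt size_poly_gt0 r0.
move=> i x; rewrite (mnm_one x) -/(mono1 _); move: (x ord0) => j.
have HE : phi H`_i = h * G1`_i + s`_i * T ^+ (m.+1 * N).
  have := congr1 (fun p : {poly mfps 1 K} => p`_i) H0.
  rewrite !coefB !coefZ coef_map coef0 => /eqP; rewrite subr_eq0 => /eqP.
  by move=> /(canRL (subrK _)) ->; rewrite addrC [s`_i * _]mulrC.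
(* Below [m.+1 * N] the multiple of the power of [T] is invisible; from there on [H] vanishes by its
   weight. *)
have [jN|Nj] := ltnP j (m.+1 * N); [right|left].
  by rewrite HE mfpsDE mulTX_lt // addr0.
rewrite phiE mono1E; have [//|/Hw Hij] := eqVneq H`_i`_j 0.
have N0 : (0 < m.+1 * N)%N by rewrite NE.
by exfalso; lia.
Qed.

End AuxiliaryPolynomial.

(** * Condition (c): conjugate roots *)

Section Conjugate.
Variables (R : realType) (K : fieldType) (v : K -> R).
Hypothesis v_abs : absolute_value v.
Hypothesis char0 : [pchar K] =i pred0.
Hypothesis K_closed : GRing.closed_field_axiom K.
Local Notation phi := (horner_alg (mfpsX ord0 : mfps 1 K)).
Local Notation conv := (convergent v 1).
Local Notation T := (@tser K).

(** If [f] vanished at [g], the Bezout relation at [g] would make a nonzero element of K[t] vanish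
    as a series. *)
Lemma ev_irreducible_neq0 (Gam f : {poly {poly K}}) (g : mfps 1 K) :
  Gam \is monic -> ring_irreducible Gam -> root (map_poly phi Gam) g ->
  f != 0 -> (size f < size Gam)%N -> ev f g != 0.
Proof.
move=> Gmon Girr /rootP Gg f0 fG.
have [u [w [d [d0 E]]]] := irreducible_bezout K_closed Gmon Girr f0 fG.
apply: contraNneq d0 => fg; apply/eqP/phi_eq0.
have : ev (u * f + w * Gam) g = phi d by rewrite E /ev map_polyC hornerC.
by rewrite evD !evM fg [ev Gam g]Gg !mulr0 addr0 => <-.
Qed.

Lemma deriv_monic_neq0 (Gam : {poly {poly K}}) :
  Gam \is monic -> (1 < size Gam)%N -> Gam^`() != 0.
Proof.
move=> Gmon G1; have sG : (size Gam).-2.+1 = (size Gam).-1 by lia.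
apply: contraT; rewrite negbK => /eqP G0.
have := congr1 (fun p : {poly {poly K}} => p`_(size Gam).-2) G0.
rewrite coef_deriv coef0 sG -/(lead_coef Gam) (monicP Gmon) => /eqP.
rewrite -polyC1 -polyCMn polyC_eq0 -sG.
by have /pcharf0P -> := char0.
Qed.

(** A weight of z exceeding the degree of every coefficient makes the leading term dominant; the sum
    of the sizes of the coefficients will do. *)
Lemma wdeg_le_exists (Gam : {poly {poly K}}) : Gam \is monic ->
  exists al, wdeg_le al (al * (size Gam).-1) Gam.
Proof.
move=> Gmon; exists (\sum_(i < size Gam) size (Gam`_i)%R)%N => i j.
set al := (\sum_(i < _) _)%N.
have [iG|Gi] := ltnP i (size Gam); last by rewrite (nth_default _ Gi) coef0 eqxx.
have [->|] := eqVneq i (size Gam).-1.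
  rewrite -/(lead_coef Gam) (monicP Gmon) coef1.
  by case: j => [|j]; rewrite ?eqxx ?add0n.
move=> ni Gij; have ja : (j <= al)%N.
  rewrite /al (bigD1 (Ordinal iG)) //=; apply: leq_trans (leq_addr _ _).
  by apply: ltnW; rewrite ltnNge; apply: contra Gij => /(nth_default 0) ->.
have i1 : (i < (size Gam).-1)%N by rewrite ltn_neqAle ni -ltnS prednK // (leq_trans _ iG).
apply: leq_trans (_ : al + al * i <= _)%N; first by rewrite leq_add2r.
by rewrite -mulnS leq_mul2l i1 orbT.
Qed.

Lemma seq_ub (xs : seq R) : exists2 D, 1 <= D & forall x, x \in xs -> x <= D.
Proof.
elim: xs => [|x xs [D D1 xsD]]; first by exists 1.
exists (Order.max x D) => [|y]; first by rewrite le_max D1 orbT.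
by rewrite in_cons le_max => /orP[/eqP ->|/xsD ->]; rewrite ?lexx ?orbT.
Qed.

Lemma convergent_conjugate : temperate_conjugate (convergent v).
Proof.
(* Exponents of [D] in the estimates below; [exp3] shows that the final one is affine in [k]. *)
have exp1 k n e : (k + n + e + 3 = (k.+1 + n + 1 + e) + 1)%N by lia.
have exp2 k n e : ((k + n + e + 3 + n).+1 <= k + 2 * n + e + 4)%N by lia.
have exp3 al Z k s s1 e : (k + 2 * (al * k + Z) + e + 4 + (s * (al * k + Z) + s1) =
  s * Z + s1 + 2 * Z + e + 4 + (s * al + 1 + 2 * al) * k)%N by ring.
move=> al Gam g g' p P al0 Girr Gmon [rs rsc Grs] gc gc' rg rg' p_deg Pp Pg.
have g_rs : g \in rs by apply: (root_split v_abs rsc gc); rewrite -Grs.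
pose l := rem g rs; pose e := (size l).+1.
have lc : {subset l <= conv} by move=> b /mem_rem /rsc.
have GE : map_poly phi Gam = \prod_(b <- g :: l) ('X - b%:P).
  by rewrite Grs; apply/perm_big/perm_to_rem.
have sG : size Gam = e.+1.
  rewrite -[RHS](size_prod_XsubC (g :: l) id) -GE size_map_poly_id0 //.
  by rewrite (monicP Gmon) rmorph1 oner_neq0.
(* The weight [be] of z is adapted to [Gam], while [al] bounds the growth of the degree of [p k] in
   t. *)
have [be] := wdeg_le_exists Gmon; rewrite sG [_.-1]/= => Gw.
have [m [a [a0 ae aw a_dvd]]] := auxiliary_poly be l.
have a'0 : ev a g' != 0 by apply: ev_irreducible_neq0 rg' a0 _; rewrite // sG ltnS.
have d'0 : ev Gam^`() g' != 0.
  apply: ev_irreducible_neq0 rg' _ _ => //; first by rewrite deriv_monic_neq0 ?sG.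
  by rewrite lt_size_deriv ?monic_neq0.
have [s [u [w [aE uw wc]]]] := convergent_order v_abs (convergent_ev v_abs a gc') a'0.
have [s1 [u1 [w1 [dE uw1 wc1]]]] :=
  convergent_order v_abs (convergent_ev v_abs Gam^`() gc') d'0.
pose G1 : {poly mfps 1 K} := \prod_(b <- l) ('X - b%:P).
pose fs := [:: ev a g; g'; w; w1] ++ [seq G1`_i | i <- iota 0 e].
have [|r0 [B [r00 B0 fsB]]] := @convergent_l1_seq R K v v_abs 1 fs.
  move=> f; rewrite mem_cat => /orP[|/mapP[i _ ->]]; last exact: convergent_prod_XsubC.
  rewrite !in_cons in_nil orbF => /or4P[]/eqP -> //; exact: convergent_ev.
have /convergentP[A1 [B1 [A10 B10 Pg_bd]]] := Pg.
(* Half of [A1] leaves room for the passage from a supremum bound to an l1-bound. *)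
pose A := Order.min r0 (A1 / 2).
have A0 : 0 < A by rewrite lt_min r00 divr_gt0.
have [Ar0 AA1] : A <= r0 /\ A <= A1 / 2 by rewrite !ge_min !lexx orbT.
have iA0 : 0 < A^-1 by rewrite invr_gt0.
have iA10 : 0 < A1^-1 by rewrite invr_gt0.
(* A single [D] at least 1 dominates all constants, so that every estimate becomes a power of
   [D]. *)
have [D D1 DP] := seq_ub [:: B; e%:R; A^-1; B1 * 2; A1^-1].
have BD : B <= D by apply: DP; rewrite mem_head.
have eD : e%:R <= D by apply: DP; rewrite !in_cons eqxx orbT.
have AD : A^-1 <= D by apply: DP; rewrite !in_cons eqxx !orbT.
have B1D : B1 * 2 <= D by apply: DP; rewrite !in_cons eqxx !orbT.
have A1D : A1^-1 <= D by apply: DP; rewrite !in_cons eqxx !orbT.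
have D0 : 0 < D := lt_le_trans ltr01 D1.
have radius (f : mfps 1 K) C : l1le v (fun=> r0) C f -> l1le v (fun=> A) C f.
  by apply: l1le_radius => // i; rewrite (ltW A0).
have fsD f : f \in fs -> l1le v (fun=> A) D f.
  move=> /fsB/radius; exact: l1le_le.
have A0' : forall i : 'I_1, 0 <= (fun=> A) i by move=> i; apply: ltW.
have aD : l1le v (fun=> A) D (ev a g) by apply: fsD; rewrite mem_head.
have gD : l1le v (fun=> A) D g' by apply: fsD; rewrite !in_cons eqxx orbT.
have wD : l1le v (fun=> A) D w by apply: fsD; rewrite !in_cons eqxx !orbT.
have w1D : l1le v (fun=> A) D w1 by apply: fsD; rewrite !in_cons eqxx !orbT.
have G1D i : (i < e)%N -> l1le v (fun=> A) D G1`_i.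
  move=> ie; apply: fsD; rewrite mem_cat; apply/orP; right.
  by apply/mapP; exists i => //; rewrite mem_iota.
have pD k : l1le v (fun=> A) (D ^+ k.+1) (ev (p k) g).
  rewrite -(slice_eval g k Pp); apply: (@l1le_radius _ _ _ v_abs _ (fun=> A1 / 2)).
    by move=> i; rewrite (ltW A0).
  apply: (@l1le_le _ _ _ _ _ (B1 * A1^-1 ^+ k * 2 ^+ 1)).
    rewrite expr1 mulrAC exprS.
    apply: ler_pM; rewrite ?exprn_ge0 ?mulr_ge0 ?(ltW iA10) ?(ltW B10) //.
    by rewrite lerXn2r // ?nnegrE ?(ltW iA10) ?(ltW D0).
  apply: l1le_sup => // x; have := Pg_bd (mono2 k (x ord0)).
  rewrite mdeg_mono2 exprD mulrCA mulrC [mdeg x](_ : _ = x ord0); last first.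
    by rewrite (mnm_one x) mdeg_mono1 mono1E.
  by rewrite exprVn -ler_pdivlMr ?exprn_gt0.
(* [N k] is the exponent prescribed by [conjugate_identity] for the weight [al * k + be * size P] of
   [p k], and [S k] is the order in [T] of a(g')^N Gam'(g'). *)
pose Z := (be * size P + be * e).+1; pose N k := (al * k + Z)%N.
have NE k : N k = (al * k + be * size P + be * e).+1 by rewrite /N addnS addnA.
pose S k := (s * N k + s1)%N.
have fw k : wdeg_le be (al * k + be * size P) (p k).
  move=> i j pij; apply: leq_add.
    rewrite -ltnS; apply: leq_trans (p_deg k i).
    by rewrite ltnNge; apply: contra pij => /(nth_default 0) ->.
  rewrite leq_mul2l; apply/orP; right; rewrite leqNgt; apply: contra pij => iP.
  have := Pp i (mono2 k j); rewrite mono2_0 mono2_max (nth_default _ (ltnW iP)) => <-.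
  exact/eqP.
(* Coefficientwise, [H] is dominated by the term of [g]. Its value at [g'] is p_k(g') a(g')^N
   Gam'(g'), from which [w] and [w1] remove the units and leave the factor [T ^+ S k]. *)
have key k j : v (ev (p k) g' (mono1 j)) * A ^+ (j + S k) <= D ^+ (k + 2 * N k + e + 4).
  have [H [He Hev Hg]] := conjugate_identity Gmon Gw GE aw a_dvd (fw k) (NE k).
  have HD i : (i < e)%N -> l1le v (fun=> A) (D ^+ (k.+1 + N k + 1)) (phi H`_i).
    move=> ie; apply: (@l1le_dom _ _ _ _ (fun=> A) _ _ (ev (p k) g * ev a g ^+ N k * G1`_i)).
      move=> x; have [->|->] := Hg i x; last by [].
      by rewrite av0 // mul0r mulr_ge0 ?(av_ge0 v_abs) ?wt_ge0.
    rewrite exprD [D ^+ (_ + N k)]exprD expr1; apply: l1leM => //; last exact: G1D.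
    by apply: l1leM => //; apply: l1leX.
  have evH : l1le v (fun=> A) (D ^+ (k + N k + e + 3)) (ev H g').
    rewrite (ev_wide _ He).
    apply: (@l1le_le _ _ _ _ _ (\sum_(i < e) D ^+ (k.+1 + N k + 1) * D ^+ i)); last first.
      by apply: l1le_sum => // i _; apply: l1leM => //; [apply: HD|apply: l1leX].
    apply: (@le_trans _ _ (\sum_(i < e) D ^+ (k.+1 + N k + 1) * D ^+ e)).
      apply: ler_sum => i _; rewrite ler_wpM2l ?exprn_ge0 ?(ltW D0) //.
      by rewrite ler_weXn2l // ltnW.
    rewrite sumr_const card_ord -mulr_natr -exprD.
    by rewrite exp1 [leRHS]exprD expr1 ler_wpM2l ?exprn_ge0 ?(ltW D0).
  have fE : ev (p k) g' * T ^+ S k = ev H g' * w ^+ N k * w1.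
    rewrite -(Hev g' rg') aE dE /S exprD exprM -[LHS]mulr1 -(expr1n _ (N k)) -uw.
    rewrite -[LHS]mulr1 -uw1 !exprMn; ring.
  have : l1le v (fun=> A) (D ^+ (k + N k + e + 3) * D ^+ N k * D) (ev (p k) g' * T ^+ S k).
    by rewrite fE; apply: l1leM => //; apply: l1leM => //; apply: l1leX.
  move=> /(l1le_coef (mono1 (j + S k))); rewrite mulTX wt_const mdeg_mono1 => h.
  by apply: le_trans h _; rewrite -exprD -exprSr ler_weXn2l.
pose c2 := (s * al + 1 + 2 * al)%N.
pose c1 := (s * Z + s1 + 2 * Z + e + 4)%N.
(* Undoing the shift by [S k] costs at most [D ^+ S k], again exponential in [k]. *)
have key2 k j : v (ev (p k) g' (mono1 j)) * A ^+ j <= D ^+ c1 * (D ^+ c2) ^+ k.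
  have AS : A ^+ S k * D ^+ S k >= 1.
    by rewrite -exprMn exprn_ege1 // mulrC -ler_pdivrMr // mul1r.
  have vA0 : 0 <= v (ev (p k) g' (mono1 j)) * A ^+ j.
    by rewrite mulr_ge0 ?(av_ge0 v_abs) ?exprn_ge0 ?(ltW A0).
  apply: le_trans (ler_peMr vA0 AS) _.
  have -> : v (ev (p k) g' (mono1 j)) * A ^+ j * (A ^+ S k * D ^+ S k) =
      v (ev (p k) g' (mono1 j)) * A ^+ (j + S k) * D ^+ S k by rewrite exprD; ring.
  apply: le_trans (ler_wpM2r _ (key k j)) _; first by rewrite exprn_ge0 ?(ltW D0).
  by rewrite -exprM -!exprD exp3.
(* A radius at most the inverse of [D ^+ c2] absorbs the growth in [k]. *)
pose A2 := Order.min A (D ^+ c2)^-1.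
have Dc2 : 0 < D ^+ c2 by rewrite exprn_gt0.
have A20 : 0 < A2 by rewrite lt_min A0 invr_gt0.
have [A2A A2D] : A2 <= A /\ A2 <= (D ^+ c2)^-1 by split; rewrite ge_min lexx ?orbT.
apply/convergentP; exists A2, (D ^+ c1); split; rewrite ?exprn_gt0 // => x.
rewrite (mono2K x) mdeg_mono2; move: (x ord0) (x ord_max) => k j.
have -> : eval_at_series P g' (mono2 k j) = ev (p k) g' (mono1 j).
  rewrite -(slice_eval g' k Pp) -[RHS]/(eval_at_series P g' (mono2 k (mono1 j ord0))).
  by rewrite mono1E.
have h : A2 ^+ (k + j) <= A ^+ j * (D ^+ c2)^-1 ^+ k.
  rewrite addnC exprD; apply: ler_pM; rewrite ?exprn_ge0 ?(ltW A20) //.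
    by rewrite lerXn2r // nnegrE ltW.
  by rewrite lerXn2r // nnegrE ltW // invr_gt0.
apply: le_trans (ler_wpM2l (av_ge0 v_abs _) h) _.
by rewrite mulrA exprVn ler_pdivrMr ?exprn_gt0.
Qed.

End Conjugate.

Theorem proposition4p5 (R : realType) (K : fieldType) (v : K -> R)
    (char0 : ([pchar K] =i pred0)%R)
    (v_abs : absolute_value v)
    (v_nontrivial : nontrivial_absolute_value v)
    (v_complete : complete_absolute_value v) :
  Weierstrass_family (convergent v) /\
  (GRing.closed_field_axiom K -> W_temperate_family (convergent v)).
Proof.
have W := convergent_weierstrass v_abs char0.
split=> // K_closed; split=> //.
- exact: av_uncountable v_abs v_nontrivial v_complete.
- by move=> n f; apply: convergent_blowup.
- exact: convergent_slices.
exact: convergent_conjugate.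
Qed.
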